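(* Let $L_1,L_2,L_3$ be linearly independent real linear forms in three variables such that $L_i(\mathbf z)\neq 0$ for every $\mathbf z\in\mathbb Z^3\setminus\{\mathbf 0\}$ and every $i\in\{1,2,3\}$. Consider the lattice $$\Lambda=\big\{\big(L_1(\mathbf z),L_2(\mathbf z),L_3(\mathbf z)\big)\,\big|\,\mathbf z\in\mathbb Z^3\big\}\subset\mathbb R^3 .$$ Let $\mathcal K_1,\ldots,\mathcal K_8$ be the Klein polyhedra corresponding to $L_1,L_2,L_3$, and let $\mathcal V$ be the set of all their vertices. Then $$\omega(\Lambda)\leq\frac23\,\limsup_{\substack{\mathbf v\in\mathcal V,\ |\mathbf v|>1\\ |\mathbf v|\to\infty}}\frac{\log(\det\mathrm{St}_{\mathbf v})}{\log|\mathbf v|}.$$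
   Context: Throughout, $|\cdot|$ denotes the sup-norm on $\mathbb R^3$. Diophantine exponent of a lattice. For $\mathbf x=(x_1,\ldots,x_n)\in\mathbb R^n$ put $\Pi(\mathbf x)=|x_1\cdots x_n|^{1/n}$ (here $n=3$). For a full-rank lattice $\Lambda\subset\mathbb R^n$ its Diophantine exponent is $$\omega(\Lambda)=\sup\big\{\gamma\in\mathbb R\ \big|\ \text{there are infinitely many } \mathbf x\in\Lambda \text{ with } \Pi(\mathbf x)\leq|\mathbf x|^{-\gamma}\big\}.$$ Klein polyhedra. The zero subspaces (kernels) of $L_1,L_2,L_3$ divide $\mathbb R^3$ into eight closed simplicial cones. In each of these cones take the convex hull of the nonzero points of $\mathbb Z^3$ lying in it. The resulting eight convex hulls $\mathcal K_1,\ldots,\mathcal K_8$ (in arbitrary order) are the Klein polyhedra corresponding to $L_1,L_2,L_3$. It is known that, if the forms do not vanish at nonzero integer points, each $\mathcal K_i$ is a generalized polyhedron (its intersection with any compact polytope is a polytope), so in particular each vertex is incident to finitely many edges. Determinant of an edge star. Let $\mathbf v$ be a vertex of one of the Klein polyhedra $\mathcal K$, and let $\mathbf r_1,\ldots,\mathbf r_k$ be the primitive vectors of $\mathbb Z^3$ parallel to the edges of $\mathcal K$ incident to $\mathbf v$ (one vector for each edge). The edge star of $\mathbf v$ (the collection of edges incident to $\mathbf v$) is denoted $\mathrm{St}_{\mathbf v}$, and its determinant is $$\det\mathrm{St}_{\mathbf v}=\sum_{1\leq i_1<i_2<i_3\leq k}\big|\det(\mathbf r_{i_1},\mathbf r_{i_2},\mathbf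 r_{i_3})\big|.$$ *)

(* Defs.v *)
From HB Require Import structures.
From mathcomp Require Import all_boot all_order all_algebra finmap.
From mathcomp Require Import all_classical all_reals all_analysis.

Set Implicit Arguments.
Unset Strict Implicit.
Unset Printing Implicit Defensive.

Import Order.TTheory GRing.Theory Num.Theory.
Import numFieldNormedType.Exports.

Local Open Scope classical_set_scope.
Local Open Scope ring_scope.

(* Three linear forms in three variables are encoded by the matrix L whose
   i-th row contains the coefficients of L_i; thus L_i(x) = (L *m x) i 0.
   The norm of MathComp-Analysis on matrices, `|x|, is the sup-norm. *)

Definition int_vec (R : realType) n (z : 'cV[int]_n) : 'cV[R]_n :=
  map_mx intr z.

Definition form_lattice (R : realType) n (L : 'M[R]_n) : set 'cV[R]_n :=
  [set L *m int_vec R z | z in [set: 'cV[int]_n]].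

Definition Pi_mean (R : realType) n (x : 'cV[R]_n) : R :=
  `|\prod_(i < n) x i 0| `^ (n%:R^-1).

(* At x = 0 the power takes a conventional value; a single point does not
   affect the condition that there be infinitely many of them. *)
Definition diophantine_exponent (R : realType) n (Lam : set 'cV[R]_n) : \bar R :=
  ereal_sup [set gam%:E | gam in [set gam : R |
    infinite_set [set x | Lam x /\ Pi_mean x <= `|x| `^ (- gam)]]].

Definition convex_hull (R : realType) n (A : set 'cV[R]_n) : set 'cV[R]_n :=
  smallest (@convex_set R 'cV[R]_n) A.

(* The sign vector s selects one of the eight closed cones into which the
   kernels of the forms divide the space. *)
Definition form_cone (R : realType) (L : 'M[R]_3) (s : {ffun 'I_3 -> bool}) :
    set 'cV[R]_3 :=
  [set x | forall i, 0 <= (-1) ^+ s i * (L *m x) i 0].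

Definition klein_polyhedron (R : realType) (L : 'M[R]_3)
    (s : {ffun 'I_3 -> bool}) : set 'cV[R]_3 :=
  convex_hull (form_cone L s `&`
    [set int_vec R z | z in [set z : 'cV[int]_3 | z != 0]]).

(* F is cut out of K by a supporting hyperplane (or F = K, when f = 0), or is
   empty. *)
Definition is_face (R : realType) n (K F : set 'cV[R]_n) : Prop :=
  exists f : 'rV[R]_n,
    F = [set x | K x /\ forall y, K y -> (f *m x) 0 0 <= (f *m y) 0 0].

Definition is_vertex (R : realType) n (K : set 'cV[R]_n) (v : 'cV[R]_n) : Prop :=
  is_face K [set v].

(* A face whose affine hull is a line. *)
Definition is_edge (R : realType) n (K E : set 'cV[R]_n) : Prop :=
  is_face K E /\
  exists p q, [/\ p != q, E p, E q &
    E `<=` [set p + t *: (q - p) | t in [set: R]]].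

Definition primitive n (r : 'cV[int]_n) : Prop :=
  \big[gcdz/0]_(i < n) r i 0 = 1.

(* Of the two opposite primitive vectors parallel to an edge incident to v we
   take the one pointing from v along the edge. As a vertex is never interior
   to an edge, each edge incident to v yields a single vector, and distinct
   edges yield distinct vectors. *)
Definition edge_vectors (R : realType) n (K : set 'cV[R]_n) (v : 'cV[R]_n) :
    set 'cV[int]_n :=
  [set r | primitive r /\
    exists E, [/\ is_edge K E, E v &
      exists2 t : R, 0 < t & E (v + t *: int_vec R r)]].

Definition det3 (r1 r2 r3 : 'cV[int]_3) : int :=
  \det (\matrix_(a < 3, b < 3) ([:: r1; r2; r3]`_b) a 0).

Definition klein_vertices (R : realType) (L : 'M[R]_3) : set 'cV[R]_3 :=
  [set v | exists s, is_vertex (klein_polyhedron L s) v].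

(* When the forms do not vanish at nonzero integer points, the eight Klein
   polyhedra are pairwise disjoint, so a vertex v determines s. *)
Definition star_vectors (R : realType) (L : 'M[R]_3) (v : 'cV[R]_3) :
    set 'cV[int]_3 :=
  [set r | exists2 s, is_vertex (klein_polyhedron L s) v &
    edge_vectors (klein_polyhedron L s) v r].

(* The set of star vectors is then also finite; fset_set enumerates it, in an
   order on which the sum does not depend. *)
Definition det_star (R : realType) (L : 'M[R]_3) (v : 'cV[R]_3) : int :=
  let rs := enum_fset (fset_set (star_vectors L v)) in
  \sum_(i1 < size rs) \sum_(i2 < size rs | (i1 < i2)%N)
    \sum_(i3 < size rs | (i2 < i3)%N) `|det3 rs`_i1 rs`_i2 rs`_i3|.

(* The neighbourhoods of infinity in the set of vertices v with |v| > 1. *)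
Definition large_vertices (R : realType) (L : 'M[R]_3) :
    set_system 'cV[R]_3 :=
  filter_from [set: R]
    (fun N => [set v | [/\ klein_vertices L v, 1 < `|v| & N < `|v|]]).

Definition limsup_log_det_star (R : realType) (L : 'M[R]_3) : \bar R :=
  limf_esup (fun v => (ln (det_star L v)%:~R / ln `|v|)%:E) (large_vertices L).

(* Main.v *)
Require Import Defs.
From HB Require Import structures.
From mathcomp Require Import all_boot all_order all_algebra finmap.
From mathcomp Require Import all_classical all_reals all_analysis.
From mathcomp Require Import ring lra zify.
Import Order.TTheory GRing.Theory Num.Theory.
Import numFieldNormedType.Exports.
Local Open Scope classical_set_scope.
Local Open Scope ring_scope.

Set Implicit Arguments.
Unset Strict Implicit.
Unset Printing Implicit Defensive.

(** Start from a nonzero lattice point [x] with small [|x_1 x_2 x_3|].  In its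
    cone, minimise the strictly concave function [sum_i sqrt (y_i / x_i)] over
    the lattice points [y]; the minimum [v] is a vertex, exposed by the gradient
    [f], and [v_i <= 9 x_i].  By Dickson's lemma for [floor (y_i / v_i)], every
    lattice point [y <> v] of the cone dominates, up to an error less than [v],
    one of finitely many; hence the differences [y - v] generate a finitely
    generated cone, whose extreme rays are the edges at [v].
    Let [r] be any edge vector at [v].  Writing [v] as a nonnegative combination
    of three independent edge vectors [r, r', r''] in which [r] has a positive
    coefficient [a] gives [|det (r, r', r'')| = |det (v, r', r'')| / a >= 1 / a
    >= f r / f v], so [f r] is at most a constant times the determinant [D] of
    the star, and [f] controls the coordinates of [r] relative to [x].  As the
    edge vectors span, [|det (v, r', r'')| >= 1] for some [r', r''], and this
    integer determinant is at most a constant times [D ^ 2 |x_1 x_2 x_3|].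
    Thus [D >= c |x_1 x_2 x_3| ^ (- 1 / 2)]. *)

(** * Finitely generated cones *)

Section Cones.
Variables (R : realFieldType) (n : nat).
Implicit Types (g : 'rV[R]_n) (x y s b : 'cV[R]_n) (S : seq 'cV[R]_n).

Definition pairing g x : R := (g *m x) 0 0.

Lemma pairingDr g x y : pairing g (x + y) = pairing g x + pairing g y.
Proof. by rewrite /pairing mulmxDr mxE. Qed.

Lemma pairingZr g (a : R) x : pairing g (a *: x) = a * pairing g x.
Proof. by rewrite /pairing -scalemxAr mxE. Qed.

Lemma pairing0r g : pairing g 0 = 0.
Proof. by rewrite /pairing mulmx0 mxE. Qed.

Lemma pairingNr g x : pairing g (- x) = - pairing g x.
Proof. by rewrite /pairing mulmxN mxE. Qed.

Lemma pairingBr g x y : pairing g (x - y) = pairing g x - pairing g y.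
Proof. by rewrite pairingDr pairingNr. Qed.

Lemma pairingDl (g h : 'rV[R]_n) x : pairing (g + h) x = pairing g x + pairing h x.
Proof. by rewrite /pairing mulmxDl mxE. Qed.

Lemma pairingZl g (a : R) x : pairing (a *: g) x = a * pairing g x.
Proof. by rewrite /pairing -scalemxAl mxE. Qed.

Lemma pairing0l x : pairing 0 x = 0.
Proof. by rewrite /pairing mul0mx mxE. Qed.

Lemma pairingBl (g h : 'rV[R]_n) x : pairing (g - h) x = pairing g x - pairing h x.
Proof. by rewrite -scaleN1r pairingDl pairingZl mulN1r. Qed.

(** The generators are peeled off one at a time, so that facts about nonnegative combinations go by
    induction on the list. *)
Fixpoint cone S y : Prop :=
  if S is s :: S' then exists2 c : R, 0 <= c & cone S' (y - c *: s) else y = 0.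

Lemma cone0 S : cone S 0.
Proof. by elim: S => //= s S IH; exists 0 => //; rewrite scale0r subr0. Qed.

Lemma coneD S x y : cone S x -> cone S y -> cone S (x + y).
Proof.
elim: S x y => [|s S IH] x y /=; first by move=> -> ->; rewrite addr0.
move=> [c c0 xS] [d d0 yS]; exists (c + d); first exact: addr_ge0.
by rewrite scalerDl opprD addrACA; exact: IH.
Qed.

Lemma coneZ S (a : R) x : 0 <= a -> cone S x -> cone S (a *: x).
Proof.
move=> a0; elim: S x => [|s S IH] x /=; first by move=> ->; rewrite scaler0.
move=> [c c0 xS]; exists (a * c); first exact: mulr_ge0.
by rewrite -scalerA -scalerBr; exact: IH.
Qed.

Lemma mem_cone S s : s \in S -> cone S s.
Proof.
elim: S => //= t S IH; rewrite in_cons => /orP[/eqP<-|/IH sS].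
  by exists 1; rewrite // scale1r subrr; exact: cone0.
by exists 0; rewrite // scale0r subr0.
Qed.

Lemma cone_trans S S' y :
  {in S, forall s, cone S' s} -> cone S y -> cone S' y.
Proof.
elim: S y => [|s S IH] y /= SS'; first by move=> ->; exact: cone0.
move=> [c c0 /IH yS]; rewrite -(subrK (c *: s) y); apply: coneD.
  by apply: yS => t tS; apply: SS'; rewrite in_cons tS orbT.
by apply: coneZ => //; apply: SS'; rewrite mem_head.
Qed.

Lemma cone_ge0 S g y :
  {in S, forall s, 0 <= pairing g s} -> cone S y -> 0 <= pairing g y.
Proof.
elim: S y => [|s S IH] y /= gS; first by move=> ->; rewrite pairing0r.
move=> [c c0 /IH]; rewrite pairingBr pairingZr subr_ge0 => h.
apply: le_trans (h _); last by move=> t tS; apply: gS; rewrite in_cons tS orbT.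
by apply: mulr_ge0 => //; apply: gS; rewrite mem_head.
Qed.

(** A sum of nonnegative terms that is at most 0 has only zero terms, so the generators at which [g]
    is positive occur in [y] with coefficient 0. *)
Lemma cone_face S g y :
  {in S, forall s, 0 <= pairing g s} -> cone S y -> pairing g y <= 0 ->
  cone [seq s <- S | pairing g s == 0] y.
Proof.
elim: S y => [//|s S IH] y /= gS [c c0 yS] gy.
have gS' : {in S, forall s, 0 <= pairing g s}.
  by move=> t tS; apply: gS; rewrite in_cons tS orbT.
have gs : 0 <= pairing g s by apply: gS; rewrite mem_head.
have := cone_ge0 gS' yS; rewrite pairingBr pairingZr subr_ge0 => h.
have cgs : 0 <= c * pairing g s by exact: mulr_ge0.
have gy' : pairing g (y - c *: s) <= 0.
  by rewrite pairingBr pairingZr; lra.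
have yS' := IH _ gS' yS gy'.
case: eqP => [gs0|/eqP gs0]; first by exists c.
suff c00 : c = 0 by move: yS'; rewrite c00 scale0r subr0.
apply/eqP; have : c * pairing g s == 0 by apply/eqP; lra.
by rewrite mulf_eq0 (negbTE gs0) orbF.
Qed.

Lemma cone_mulr_gt0 S g y : {in S, forall s, 0 < pairing g s} -> cone S y ->
  y != 0 -> 0 < pairing g y.
Proof.
move=> gS yS; apply: contra_neqT; rewrite -leNgt => gy.
have gS' : {in S, forall s, 0 <= pairing g s} by move=> s /gS/ltW.
move: (cone_face gS' yS gy).
rewrite (_ : [seq _ <- _ | _] = [::]) //.
by apply/eqP; rewrite -(negbK (_ == _)) -has_filter -all_predC;
   apply/allP => s /gS /=; rewrite lt0r => /andP[].
Qed.

(* Bartl's induction: if the functional [g] obtained for the tail is negative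
   on the head [s], project everything onto the kernel of [g] along [s]. *)
Lemma farkas S b : ~ cone S b ->
  exists g, {in S, forall s, 0 <= pairing g s} /\ pairing g b < 0.
Proof.
have [m] := ubnP (size S); elim: m S b => // m IH [|s S] b /= Sm nb.
  have /cV0Pn[i bi] : b != 0 by apply/eqP.
  exists (- b i 0 *: delta_mx 0 i); split=> //.
  rewrite pairingZl /pairing -rowE mxE mulNr oppr_lt0.
  by rewrite -expr2 exprn_even_gt0.
have [|g [gS gb]] := IH S b Sm.
  by move=> bS; apply: nb; exists 0; rewrite // scale0r subr0.
have [gs|gs] := leP 0 (pairing g s).
  by exists g; split=> // t; rewrite in_cons => /orP[/eqP->//|/gS].
pose p x := x - (pairing g x / pairing g s) *: s.
have [||h [hS hb]] := IH (map p S) (p b); first by rewrite size_map.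
  (* If [p b] lay in the projected cone, [b] would lie in the original one: undoing the projection
     adds nonnegative multiples of [s], because [g s] and [g b] are negative while [g] is
     nonnegative on the tail. *)
  move=> pb; apply: nb; rewrite -/(cone (s :: S) b) -(subrK ((pairing g b / pairing g s) *: s) b).
  apply: coneD; last first.
    apply: coneZ; last by apply: mem_cone; rewrite mem_head.
    by rewrite ltW // nmulr_lgt0 ?invr_lt0.
  apply: cone_trans pb => _ /mapP[t tS ->]; apply: coneD.
    by apply: mem_cone; rewrite in_cons tS orbT.
  rewrite -scaleNr; apply: coneZ; last by apply: mem_cone; rewrite mem_head.
  by rewrite -mulrN mulr_ge0 ?gS // oppr_ge0 ltW ?invr_lt0.
(* This functional is [h] composed with [p]; it vanishes at [s]. *)
exists (h - (pairing h s / pairing g s) *: g).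
have hE x : pairing (h - (pairing h s / pairing g s) *: g) x = pairing h (p x).
  rewrite pairingBl pairingZl /p pairingBr pairingZr; congr (_ - _).
  by rewrite mulrAC [RHS]mulrAC [in RHS](mulrC (pairing g x)).
split; last by rewrite hE.
move=> t; rewrite hE in_cons => /orP[/eqP->|tS].
  by rewrite /p divff ?lt_eqF // scale1r subrr pairing0r.
by apply: hS; exact: map_f.
Qed.

(** Generators spanned by the others are discarded until none is left. As [rem] deletes a single
    occurrence, the resulting list has no repetitions. *)
Lemma irredundant_subset S : exists S', [/\ {subset S' <= S},
  {in S, forall s, cone S' s} & {in S', forall s, ~ cone (rem s S') s}].
Proof.
have [m] := ubnP (size S); elim: m S => // m IH S Sm.
have [irr|] := pselect {in S, forall s, ~ cone (rem s S) s}.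
  by exists S; split=> // s; exact: mem_cone.
move=> /existsNP[s /not_implyP[sS /contrapT sc]].
have [|S' [S'S SS' irr]] := IH (rem s S).
  by rewrite size_rem // prednK // -has_predT; apply/hasP; exists s.
exists S'; split=> // [t /S'S|t tS]; first exact: mem_rem.
have [->|ts] := eqVneq t s; first by apply: cone_trans sc.
by apply: SS'; move: tS; rewrite (perm_mem (perm_to_rem sS)) in_cons (negPf ts).
Qed.

(* Gordan's alternative modulo the line of [s]. *)
Lemma exposed_ray S f s : {in S, forall t, 0 < pairing f t} ->
  s \in S -> ~ cone (rem s S) s ->
  exists g, pairing g s = 0 /\ {in rem s S, forall t, 0 < pairing g t}.
Proof.
move=> fS sS ns.
(* Farkas is applied to [- t] with both [s] and [- s] among the generators, which forces [g s = 0].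
   If it failed, some [y] in the cone of the other generators would make [y + t] a multiple of [s];
   positivity of [f] makes the factor positive, so [s] would be redundant. *)
have sep t : t \in rem s S -> exists g, [/\ pairing g s = 0,
    {in rem s S, forall u, 0 <= pairing g u} & 0 < pairing g t].
  move=> tS; have [|g [gS gt]] := @farkas [:: s, - s & rem s S] (- t).
    move=> [c c0 [d d0]]; set y := - t - _ - _ => yS.
    have yE : y + t = (d - c) *: s.
      by rewrite /y scalerN opprK scalerBl addrC !addrA subrr add0r addrC.
    have dc : c < d.
      rewrite ltNge -subr_le0 -(@pmulr_lle0 _ (pairing f s)) ?(fS _ sS) //.
      rewrite -pairingZr -yE pairingDr -ltNge ltr_wpDl ?(fS _ (mem_rem tS)) //.
      by apply: cone_ge0 yS => u /mem_rem/fS/ltW.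
    apply: ns; rewrite -[X in cone _ X](scalerK (a := d - c)) ?subr_eq0 ?gt_eqF //.
    apply: coneZ; first by rewrite invr_ge0 subr_ge0 ltW.
    by rewrite -yE; apply: coneD => //; exact: mem_cone.
  have gs : 0 <= pairing g s by apply: gS; rewrite mem_head.
  have gs' : 0 <= pairing g (- s) by apply: gS; rewrite !in_cons eqxx orbT.
  move: gs' gt; rewrite !pairingNr oppr_ge0 oppr_lt0 => gs' gt.
  exists g; split=> [|u uS|//]; first by apply/eqP; rewrite eq_le gs' gs.
  by apply: gS; rewrite !in_cons uS !orbT.
(* The sum of the functionals found for the individual [t] is positive at all of them. *)
suff /(_ (rem s S)) [//|g [gs _ gS]] : forall T : seq 'cV[R]_n, {subset T <= rem s S} ->
    exists g, [/\ pairing g s = 0, {in rem s S, forall u, 0 <= pairing g u} &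
      {in T, forall u, 0 < pairing g u}].
  by exists g.
elim=> [_|t T IH TS]; first by exists 0; split=> [|u _|//]; rewrite pairing0l.
have [g [gs gS gt]] := sep t (TS _ (mem_head _ _)).
have [u uT|h [hs hS hT]] := IH; first by apply: TS; rewrite in_cons uT orbT.
exists (g + h); split=> [|u uS|u]; rewrite ?pairingDl.
- by rewrite gs hs addr0.
- by rewrite addr_ge0 ?gS ?hS.
rewrite in_cons => /orP[/eqP->|uT].
  by rewrite ltr_wpDr // hS // TS ?mem_head.
by rewrite ltr_wpDl ?hT // gS // TS // in_cons uT orbT.
Qed.

End Cones.

(** * Determinants and bases of cones in dimension three *)

Lemma ord3P (P : 'I_3 -> Prop) : P 0 -> P 1 -> P 2 -> forall i, P i.
Proof.
by move=> P0 P1 P2 [[|[|[|//]]] i]; [move: P0|move: P1|move: P2];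
  congr P; exact: val_inj.
Qed.

Lemma big_ord3 (T : Type) (idx : T) (op : Monoid.law idx) (F : 'I_3 -> T) :
  \big[op/idx]_i F i = op (op (F 0) (F 1)) (F 2).
Proof.
rewrite !big_ord_recl big_ord0 Monoid.mulm1 Monoid.mulmA.
by congr (op (op (F _) (F _)) (F _)); exact: val_inj.
Qed.

Lemma det_mx2 (R : comNzRingType) (A : 'M[R]_2) :
  \det A = A 0 0 * A 1 1 - A 0 1 * A 1 0.
Proof.
rewrite (expand_det_col _ 0) !big_ord_recl big_ord0 /cofactor !det_mx11 !mxE /=.
have l0 : lift (0 : 'I_2) (0 : 'I_1) = 1 by exact: val_inj.
have l1 : lift (1 : 'I_2) (0 : 'I_1) = 0 by exact: val_inj.
by rewrite !l0 !l1 /=; ring.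
Qed.

(** The determinant of [det3] over any commutative ring, so that integer and real columns share one
    expansion. *)
Definition det_cols (R : comNzRingType) (a b c : 'cV[R]_3) : R :=
  \det (\matrix_(i < 3, j < 3) [:: a; b; c]`_j i 0).

Lemma det_colsE (R : comNzRingType) (a b c : 'cV[R]_3) :
  det_cols a b c = a 0 0 * b 1 0 * c 2 0 - a 0 0 * b 2 0 * c 1 0
    - a 1 0 * b 0 0 * c 2 0 + a 1 0 * b 2 0 * c 0 0
    + a 2 0 * b 0 0 * c 1 0 - a 2 0 * b 1 0 * c 0 0.
Proof.
rewrite /det_cols (expand_det_col _ 0) big_ord3 /cofactor !det_mx2 !mxE.
have l00 : lift (0 : 'I_3) 0 = 1 by exact: val_inj.
have l01 : lift (0 : 'I_3) 1 = 2 by exact: val_inj.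
have l10 : lift (1 : 'I_3) 0 = 0 by exact: val_inj.
have l11 : lift (1 : 'I_3) 1 = 2 by exact: val_inj.
have l20 : lift (2 : 'I_3) 0 = 0 by exact: val_inj.
have l21 : lift (2 : 'I_3) 1 = 1 by exact: val_inj.
rewrite l00 l01 l10 l11 l20 l21 /=.
by ring.
Qed.

Lemma det_cols_mulmx (R : comNzRingType) (L : 'M[R]_3) (a b c : 'cV[R]_3) :
  det_cols (L *m a) (L *m b) (L *m c) = \det L * det_cols a b c.
Proof.
rewrite -det_mulmx; congr (\det _); apply/matrixP => i j; rewrite !mxE.
by case: j => [[|[|[|//]]] j] /=; rewrite mxE; apply: eq_bigr => k _;
  rewrite mxE.
Qed.

(** * Cramer's rule, simplex pivots and Caratheodory's theorem *)

Section Pivot.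
Variables (R : realFieldType).
Implicit Types (a b c s x y : 'cV[R]_3).

Lemma cV3P x y : x 0 0 = y 0 0 -> x 1 0 = y 1 0 -> x 2 0 = y 2 0 -> x = y.
Proof.
by move=> h0 h1 h2; apply/matrixP => i j; rewrite (ord1 j); move: i; exact: ord3P.
Qed.

Lemma cramer3 a b c s :
  det_cols a b c *: s =
  det_cols s b c *: a + det_cols a s c *: b + det_cols a b s *: c.
Proof. by apply: cV3P; rewrite !mxE !det_colsE; ring. Qed.

Lemma det_cols_lin1 a b c (p q r : R) :
  det_cols (p *: a + q *: b + r *: c) b c = p * det_cols a b c.
Proof. by rewrite !det_colsE !mxE; ring. Qed.

Lemma det_cols_lin2 a b c (p q r : R) :
  det_cols a (p *: a + q *: b + r *: c) c = q * det_cols a b c.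
Proof. by rewrite !det_colsE !mxE; ring. Qed.

Lemma det_cols_lin3 a b c (p q r : R) :
  det_cols a b (p *: a + q *: b + r *: c) = r * det_cols a b c.
Proof. by rewrite !det_colsE !mxE; ring. Qed.

(** The ratio test of the simplex method: [t] is the largest value keeping [b1 - t * d1] and
    [b2 - t * d2] nonnegative, and the alternative tells which of them vanishes. *)
Lemma ratio_test (b1 b2 d1 d2 : R) : 0 <= b1 -> 0 <= b2 -> 0 < d1 \/ 0 < d2 ->
  exists2 t, 0 <= t &
    [/\ 0 < d1, b1 = t * d1 & t * d2 <= b2] \/
    [/\ 0 < d2, b2 = t * d2 & t * d1 <= b1].
Proof.
move=> b10 b20 d.
wlog d1p : b1 b2 d1 d2 b10 b20 d / 0 < d1.
  move=> W; case: (d) => dp; first exact: (W b1 b2 d1 d2).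
  have [||||t t0 h] := W b2 b1 d2 d1 => //; first by left.
  by exists t => //; case: h => h; [right|left].
have [h|h] := leP (b1 / d1 * d2) b2.
  exists (b1 / d1); first by rewrite divr_ge0 // ltW.
  by left; split=> //; rewrite divfK // gt_eqF.
have d2p : 0 < d2.
  by rewrite ltNge; apply/negP => d20; have := divr_ge0 b10 (ltW d1p); nra.
exists (b2 / d2); first by rewrite divr_ge0 // ltW.
right; split=> //; first by rewrite divfK // gt_eqF.
by move: h; rewrite mulrAC ltr_pdivlMr // => h; rewrite mulrAC ler_pdivrMr // ltW.
Qed.

(* The simplex pivot: [s] enters the cone basis, [a] may not leave it. *)
Lemma pivot f a j k s x (al be ga c : R) :
  0 < pairing f a -> 0 < pairing f j -> 0 < pairing f k -> 0 < pairing f s ->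
  det_cols a j k != 0 -> 0 < al -> 0 <= be -> 0 <= ga -> 0 <= c ->
  x = al *: a + be *: j + ga *: k + c *: s ->
  exists j' k' al' be' ga', [/\ j' \in [:: j; k; s], k' \in [:: j; k; s],
    det_cols a j' k' != 0, [/\ 0 < al', 0 <= be' & 0 <= ga'] &
    x = al' *: a + be' *: j' + ga' *: k'].
Proof.
move=> fa fj fk fs D0 al0 be0 ga0 c0 xE.
have [s0 [s1 [s2 sE]]] : exists s0 s1 s2 : R, s = s0 *: a + s1 *: j + s2 *: k.
  exists (det_cols s j k / det_cols a j k), (det_cols a s k / det_cols a j k),
    (det_cols a j s / det_cols a j k).
  apply: (scalerI D0); rewrite cramer3 !scalerDr !scalerA.
  by rewrite !(mulrCA (det_cols a j k)) divff // !mulr1.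
have jk : (j \in [:: j; k; s]) * (k \in [:: j; k; s]) * (s \in [:: j; k; s]).
  by rewrite !in_cons !eqxx !orbT.
(* The parameter [u] is the amount of [s] rewritten in the basis. The procedure ends when the
   coefficient of [j] vanishes, when that of [k] vanishes, or when all of [s] is absorbed at
   [u = c]. *)
have xu u : x = (al + u * s0) *: a + (be + u * s1) *: j + (ga + u * s2) *: k
    + (c - u) *: s.
  by rewrite xE; apply: cV3P; rewrite sE !mxE; ring.
set G := ex _.
have swapj u : s1 != 0 -> 0 < al + u * s0 -> be + u * s1 = 0 ->
    0 <= ga + u * s2 -> u <= c -> G.
  move=> s10 h0 h1 h2 uc; exists s, k, (al + u * s0), (c - u), (ga + u * s2).
  split; rewrite ?jk ?subr_ge0 //; first by rewrite sE det_cols_lin2 mulf_neq0.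
  by rewrite [LHS](xu u) h1 scale0r addr0 addrAC.
have swapk u : s2 != 0 -> 0 < al + u * s0 -> ga + u * s2 = 0 ->
    0 <= be + u * s1 -> u <= c -> G.
  move=> s20 h0 h1 h2 uc; exists j, s, (al + u * s0), (be + u * s1), (c - u).
  split; rewrite ?jk ?subr_ge0 //; first by rewrite sE det_cols_lin3 mulf_neq0.
  by rewrite [LHS](xu u) h1 scale0r addr0.
have stop : 0 < al + c * s0 -> 0 <= be + c * s1 -> 0 <= ga + c * s2 -> G.
  move=> h0 h1 h2; exists j, k, (al + c * s0), (be + c * s1), (ga + c * s2).
  by split; rewrite ?jk // [LHS](xu c) subrr scale0r addr0.
have fsE : pairing f s = s0 * pairing f a + s1 * pairing f j + s2 * pairing f k.
  by rewrite {1}sE !pairingDr !pairingZr.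
move: G swapj swapk stop => G swapj swapk stop; clear xu xE sE jk D0.
(* For [s0 < 0] a value [u <= 0] does not lower the coefficient of [a]; as [f s > 0] makes [s1] or
   [s2] positive, the coefficient of [j] or [k] reaches 0. *)
have [s0n|s0p] := ltP s0 0.
  have [|t t0 [[d1 h1 h2]|[d2 h1 h2]]] := @ratio_test be ga s1 s2 be0 ga0.
  - have [s1p|s1n] := ltP 0 s1; first by left.
    by right; rewrite ltNge; apply/negP => s2n; nra.
  - by apply: (swapj (- t)); [rewrite gt_eqF|nra|lra|lra|lra].
  - by apply: (swapk (- t)); [rewrite gt_eqF|nra|lra|lra|lra].
(* For [s0 >= 0] increasing [u] does not lower the coefficient of [a]; either [u] reaches [c], or
   [j] or [k] leaves first. *)
have [/andP[h1 h2]|nstop] := boolP ((0 <= be + c * s1) && (0 <= ga + c * s2)).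
  by apply: stop => //; rewrite ltr_wpDr // mulr_ge0.
have [|t t0 alt] := @ratio_test be ga (- s1) (- s2) be0 ga0.
  have [s1p|s1n] := ltP 0 (- s1); first by left.
  right; rewrite ltNge; apply: contra nstop => s2n; apply/andP; split; nra.
have al0t : 0 < al + t * s0 by rewrite ltr_wpDr // mulr_ge0.
have tc : t <= c.
  rewrite leNgt; apply: contra nstop => ct.
  by case: alt => -[d h1 h2]; apply/andP; split; nra.
case: alt => -[d h1 h2].
  by apply: (swapj t) => //; [rewrite lt_eqF; lra|lra|lra].
by apply: (swapk t) => //; [rewrite lt_eqF; lra|lra|lra].
Qed.

(** Caratheodory's theorem with a prescribed generator [a] kept at a positive coefficient. From any
    basis through [a], the members of [S] enter one after the other by [pivot]; [T] stays fixed as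
    the pool of basis vectors. *)
Lemma caratheodory3 f (T S : seq ('cV[R]_3)) a x (al : R) : {in T, forall s, 0 < pairing f s} ->
  a \in T -> {subset S <= T} ->
  (exists j k, [/\ j \in T, k \in T & det_cols a j k != 0]) ->
  0 < al -> cone S (x - al *: a) ->
  exists j k al' be ga, [/\ j \in T, k \in T, det_cols a j k != 0,
    [/\ 0 < al', 0 <= be & 0 <= ga] & x = al' *: a + be *: j + ga *: k].
Proof.
move=> fT aT ST [j0 [k0 [j0T k0T D0]]] al0.
elim: S ST x => [|s S IH] ST x /=.
  move/eqP; rewrite subr_eq0 => /eqP->; exists j0, k0, al, 0, 0.
  by rewrite !scale0r !addr0.
move=> [c c0]; rewrite addrAC => /IH [t tS|].
  by apply: ST; rewrite in_cons tS orbT.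
move=> j [k [al' [be [ga [jT kT D1 [al'0 be0 ga0] xE]]]]].
have sT : s \in T by apply: ST; rewrite mem_head.
have [||||||||||j' [k' [al2 [be' [ga' [j'T k'T D2 pos xE']]]]]] :=
  @pivot f a j k s x al' be ga c; rewrite ?fT //.
  by rewrite -xE subrK.
have sub : {subset [:: j; k; s] <= T}.
  by move=> u; rewrite !in_cons orbF => /or3P[] /eqP->.
exists j', k', al2, be', ga'; split=> //; exact: sub.
Qed.

End Pivot.

(** * Lattice points of a cone *)

(** Induction on [k]: the list [B0] for the first [k] coordinates serves every [x] whose next
    coordinate is at least its maximum [N] over [B0]; each of the finitely many smaller values gives
    a slice with its own list. *)
Lemma dickson (T : eqType) (k : nat) (F : nat -> T -> nat) (X : T -> Prop) :
  exists B : seq T, (forall b, b \in B -> X b) /\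
    forall x, X x -> exists2 b, b \in B & forall i, (i < k)%N -> (F i b <= F i x)%N.
Proof.
elim: k X => [|k IH] X.
  have [[x0 X0]|nX] := pselect (exists x, X x); last first.
    by exists [::]; split=> // x Xx; case: nX; exists x.
  exists [:: x0]; split=> [b|x _]; first by rewrite inE => /eqP->.
  by exists x0; rewrite ?mem_head.
have [B0 [B0X B0P]] := IH X.
have /choice[Bs BsP] j := IH (fun x => X x /\ F k x = j).
pose N := \max_(b <- B0) F k b.
exists (B0 ++ flatten [seq Bs j | j <- iota 0 N]); split=> [b|x Xx].
  rewrite mem_cat => /orP[/B0X//|/flattenP[_ /mapP[j _ ->] bB]].
  by have [/(_ _ bB)[]] := BsP j.
have [FN|NF] := ltnP (F k x) N.
  have [_ /(_ x (conj Xx erefl))[b bB bx]] := BsP (F k x).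
  exists b => [|i].
    rewrite mem_cat; apply/orP; right; apply/flattenP; exists (Bs (F k x)) => //.
    by apply: map_f; rewrite mem_iota.
  rewrite ltnS leq_eqVlt => /orP[/eqP->|/bx//].
  by have [/(_ _ bB)[_ ->]] := BsP (F k x).
have [b bB bx] := B0P x Xx; exists b => [|i]; first by rewrite mem_cat bB.
rewrite ltnS leq_eqVlt => /orP[/eqP->|/bx//].
by apply: leq_trans NF; exact: (@leq_bigmax_seq _ B0 xpredT (F k)).
Qed.

Lemma positive_gap (R : realFieldType) (T : eqType) (B : seq T) (h : T -> R) :
  {in B, forall b, 0 < h b} -> exists2 mu, 0 < mu & {in B, forall b, mu <= h b}.
Proof.
elim: B => [|b B IH] hB; first by exists 1.
have [c cB|mu mu0 muB] := IH; first by apply: hB; rewrite in_cons cB orbT.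
exists (Order.min (h b) mu); first by rewrite lt_min mu0 hB ?mem_head.
by move=> c; rewrite in_cons ge_min => /orP[/eqP->|/muB->]; rewrite ?lexx ?orbT.
Qed.

Section IntVec.
Variables (R : realType) (n : nat).
Implicit Types z : 'cV[int]_n.

Lemma int_vecD z z' : int_vec R (z + z') = int_vec R z + int_vec R z'.
Proof. exact: map_mxD. Qed.

Lemma int_vecB z z' : int_vec R (z - z') = int_vec R z - int_vec R z'.
Proof. exact: map_mxB. Qed.

Lemma int_vec0 : int_vec R (0 : 'cV[int]_n) = 0.
Proof. exact: map_mx0. Qed.

Lemma int_vecMn z k : int_vec R (z *+ k) = k%:R *: int_vec R z.
Proof. by rewrite scaler_nat; exact: (raddfMn (@map_mx _ _ intr n 1)). Qed.

Lemma int_vec_inj : injective (@int_vec R n).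
Proof.
move=> z z' /matrixP h; apply/matrixP => i j.
by have := h i j; rewrite !mxE => /eqP; rewrite eqr_int => /eqP.
Qed.

Lemma int_vec_eq0 z : (int_vec R z == 0) = (z == 0).
Proof. by rewrite -int_vec0 (inj_eq int_vec_inj). Qed.

End IntVec.

(** * Signed forms and finite generation of the tangent cone at a minimal point *)

Section SignedForms.
Variables (R : realType) (L : 'M[R]_3) (s : {ffun 'I_3 -> bool}).
Implicit Types (x y : 'cV[R]_3) (z v : 'cV[int]_3) (f : 'rV[R]_3).

Definition sform x i : R := (-1) ^+ s i * (L *m x) i 0.

(** If no form vanishes at a nonzero integer point, these are exactly the nonzero integer points of
    the closed cone. *)
Definition pos z := forall i, 0 < sform (int_vec R z) i.

Lemma sformD x y i : sform (x + y) i = sform x i + sform y i.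
Proof. by rewrite /sform mulmxDr mxE mulrDr. Qed.

Lemma sformZ a x i : sform (a *: x) i = a * sform x i.
Proof. by rewrite /sform -scalemxAr mxE mulrCA. Qed.

Lemma sformB x y i : sform (x - y) i = sform x i - sform y i.
Proof. by rewrite -scaleN1r sformD sformZ mulN1r. Qed.

Lemma sform0 i : sform 0 i = 0.
Proof. by rewrite -(scale0r 0) sformZ mul0r. Qed.

Lemma pos_neq0 z : pos z -> z != 0.
Proof.
by move=> zp; apply/eqP => z0; have := zp 0; rewrite z0 int_vec0 sform0 ltxx.
Qed.

Lemma posD z v : pos z -> pos v -> pos (z + v).
Proof. by move=> zp vp i; rewrite int_vecD sformD addr_gt0. Qed.

(** Descent: if [z] dominates [b] in the rounded ratios to [v], then [v + (z - b)] is again in the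
    open cone, and its height under [f] is lower than that of [z] by at least the least gap [mu]. *)
Lemma lattice_cone v f : pos v ->
  (forall z, pos z -> z <> v -> pairing f (int_vec R v) < pairing f (int_vec R z)) ->
  exists B : seq 'cV[int]_3, (forall b, b \in B -> pos b /\ b <> v) /\
    forall z, pos z -> cone [seq int_vec R (b - v) | b <- B] (int_vec R (z - v)).
Proof.
move=> vp fv.
pose F (i : nat) z := Num.truncn (sform (int_vec R z) (inord i) /
  sform (int_vec R v) (inord i)).
have [B [BX BP]] := dickson 3 F (fun z => pos z /\ z <> v).
exists B; split=> //.
have [|mu mu0 muB] := @positive_gap R _ B (fun b => pairing f (int_vec R (b - v))).
  by move=> b /BX[bp bv]; rewrite int_vecB pairingBr subr_gt0 fv.
move=> z zp.
(* The number of descents is bounded by the height above [v] in units of [mu]; at bound 0 a point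
   other than [v] would lie below [v]. *)
have := truncnS_gt (pairing f (int_vec R (z - v)) / mu).
rewrite ltr_pdivrMr //; move: (Num.truncn _).+1 => k.
elim: k z zp => [|k IH] z zp; have [->|/eqP zv] := eqVneq z v.
- by move=> _; rewrite subrr int_vec0; exact: cone0.
- by rewrite mul0r int_vecB pairingBr subr_lt0 ltNge ltW // fv.
- by move=> _; rewrite subrr int_vec0; exact: cone0.
move=> zk; have [b bB bz] := BP z (conj zp zv).
have -> : z - v = (b - v) + (v + (z - b) - v).
  by rewrite [v + _]addrC addrK [RHS]addrC subrKA.
rewrite int_vecD; apply: coneD; first by apply: mem_cone; exact: map_f.
apply: IH => [i|].
  (* Comparing integer parts gives [b_i / v_i < z_i / v_i + 1], that is, [v_i + z_i - b_i > 0]. *)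
  have := bz i (ltn_ord i); rewrite /F inord_val -(ler_nat R) => h.
  have [bp _] := BX b bB.
  have t1 := truncnS_gt (sform (int_vec R b) i / sform (int_vec R v) i).
  have t2 : (Num.truncn (sform (int_vec R z) i / sform (int_vec R v) i))%:R
    <= sform (int_vec R z) i / sform (int_vec R v) i.
    by rewrite truncn_le divr_ge0 // ltW.
  have : sform (int_vec R b) i / sform (int_vec R v) i <
      (sform (int_vec R z) i + sform (int_vec R v) i) / sform (int_vec R v) i.
    rewrite mulrDl divff ?gt_eqF //; apply: lt_le_trans t1 _.
    by rewrite -natr1 lerD2r (le_trans _ t2).
  rewrite ltr_pM2r ?invr_gt0 // int_vecD int_vecB sformD sformB; lra.
have := muB b bB; move: zk; rewrite -natr1 mulrDl mul1r !int_vecB.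
by rewrite ?(int_vecB, int_vecD) !(pairingBr, pairingDr) => zk mb; lra.
Qed.

End SignedForms.

(** * Vertices and edge stars of Klein polyhedra *)

Section Primitive.
Variable n : nat.
Implicit Types r z : 'cV[int]_n.

Lemma primitiveE r : primitive r <-> (\big[gcdn/0]_(i < n) `|r i 0%R|)%N = 1%N.
Proof.
rewrite /primitive; have -> : \big[gcdz/0]_(i < n) r i 0 =
    (\big[gcdn/0]_(i < n) `|r i 0%R|)%N%:Z.
  by elim/big_rec2: _ => // i m g _ ->.
by split=> [[]|->].
Qed.

Lemma biggcdnMr m (F : 'I_n -> nat) :
  (\big[gcdn/0]_(i < n) (m * F i) = m * \big[gcdn/0]_(i < n) F i)%N.
Proof. by rewrite (big_morph (muln m) (muln_gcdr m) (muln0 m)). Qed.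

Lemma primitive_neq0 r : primitive r -> r != 0.
Proof.
move=> /primitiveE rP; apply/eqP => r0; move: rP.
by rewrite big1 // => i _; rewrite r0 mxE.
Qed.

Lemma primitive_part z : z != 0 ->
  exists r m, [/\ primitive r, (0 < m)%N & z = r *+ m].
Proof.
move=> z0; pose g := (\big[gcdn/0]_(i < n) `|z i 0%R|)%N.
have gz i : (g%:Z %| z i 0%R)%Z.
  by rewrite dvdzE /=; apply: (@biggcdn_inf _ i).
have g0 : (0 < g)%N.
  have /cV0Pn[i zi] := z0; rewrite lt0n; apply/eqP => g0.
  by move: (gz i); rewrite g0 dvd0z (negPf zi).
have zE : z = (\col_i (z i 0%R %/ g%:Z)%Z) *+ g.
  by apply/matrixP => i j; rewrite mulmxnE !mxE (ord1 j) -mulr_natr natz divzK.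
exists (\col_i (z i 0%R %/ g%:Z)%Z), g; split=> //; apply/primitiveE.
apply/eqP; rewrite -(eqn_pmul2l g0) muln1 -biggcdnMr; apply/eqP.
apply: eq_bigr => i _; rewrite mxE -[X in (X * _)%N](absz_nat g) -abszM.
by rewrite mulrC divzK.
Qed.

(** For a fixed [i] with [r'_i] nonzero, [|r_i| |r'_j| = |r'_i| |r_j|] for all [j]; taking the gcd
    over [j] gives [|r_i| = |r'_i|], whence [k = 1]. *)
Lemma primitive_ray (R : realType) r r' (k : R) : primitive r -> primitive r' ->
  0 < k -> int_vec R r = k *: int_vec R r' -> r = r'.
Proof.
move=> rp r'p k0 /matrixP rE.
have rkE i : (r i 0)%:~R = k * (r' i 0)%:~R :> R by have := rE i 0; rewrite !mxE.
have /cV0Pn[i r'i] := primitive_neq0 r'p.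
have cross j : (`|r i 0%R| * `|r' j 0%R| = `|r' i 0%R| * `|r j 0%R|)%N.
  rewrite -!abszM; congr absz; apply/eqP; rewrite -(eqr_int R) !intrM !rkE.
  by rewrite mulrCA mulrA [k * _]mulrC -mulrA mulrCA.
have : (`|r i 0%R| = `|r' i 0%R|)%N.
  move/primitiveE: rp => rp; move/primitiveE: r'p => r'p.
  have := biggcdnMr `|r i 0%R|%N (fun j => `|r' j 0%R|%N).
  rewrite r'p muln1 => <-; rewrite (eq_bigr _ (fun j _ => cross j)).
  by rewrite biggcdnMr rp muln1.
move=> /(congr1 (fun m : nat => m%:R : R)).
rewrite !natr_absz !intr_norm rkE normrM (gtr0_norm k0) => /eqP.
rewrite -[X in _ == X]mul1r (inj_eq (mulIf _)) ?normr_eq0 ?intr_eq0 //.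
move=> /eqP k1; apply/matrixP => j l; rewrite (ord1 l).
by apply/eqP; rewrite -(eqr_int R) rkE k1 mul1r.
Qed.

End Primitive.

Lemma convex_setP (R : realType) n (C : set 'cV[R]_n) :
  (forall x y (a b : R), 0 <= a -> 0 <= b -> a + b = 1 ->
    C x -> C y -> C (a *: x + b *: y)) -> convex_set C.
Proof.
move=> CP x y l; rewrite !inE => Cx Cy.
apply: (CP x y l%:inum (1 - l%:inum)) => //; last by rewrite addrC subrK.
Qed.

(** * Tangent cones, vertices and edges of a Klein polyhedron *)

Section Klein.
Variables (R : realType) (L : 'M[R]_3) (s : {ffun 'I_3 -> bool}).
Hypothesis L_irr : forall (z : 'cV[int]_3) (i : 'I_3),
  z != 0 -> (L *m int_vec R z) i 0 != 0.
Implicit Types (x y : 'cV[R]_3) (z v r : 'cV[int]_3) (f g : 'rV[R]_3).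

Local Notation K := (klein_polyhedron L s).

Lemma klein_mem z : pos L s z -> K (int_vec R z).
Proof.
move=> zp; apply: sub_gen_smallest; split; last by exists z => //; exact: pos_neq0 zp.
by move=> i; exact/ltW/zp.
Qed.

(** A hull lies in every convex set containing its generating points, and [L_irr] puts those points
    in the open cone. *)
Lemma klein_sub (C : set 'cV[R]_3) : convex_set C ->
  (forall z, pos L s z -> C (int_vec R z)) -> K `<=` C.
Proof.
move=> Ccvx CA; apply: smallest_sub => // x [xc [z z0 zx]].
rewrite -zx in xc *; apply: CA => i.
by rewrite lt_neqAle [X in _ && X]xc andbT eq_sym mulf_neq0 ?signr_eq0 // L_irr.
Qed.

Lemma klein_cone_sub : K `<=` form_cone L s.
Proof.
apply: klein_sub => [|z zp i]; last exact/ltW/zp.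
apply: convex_setP => x y a b a0 b0 _ xC yC i.
have := sformD L s (a *: x) (b *: y) i; rewrite /sform => ->.
by rewrite -/(sform L s (a *: x) i) -/(sform L s (b *: y) i) !sformZ
  addr_ge0 // mulr_ge0 //; [exact: xC|exact: yC].
Qed.

Lemma klein_sub_tangent (S : seq 'cV[R]_3) v :
  (forall z, pos L s z -> cone S (int_vec R (z - v))) ->
  forall x, K x -> cone S (x - int_vec R v).
Proof.
move=> Sv; apply: (@klein_sub [set x | cone S (x - int_vec R v)]).
  apply: convex_setP => x y a b a0 b0 ab1 /= xS yS.
  have -> : a *: x + b *: y - int_vec R v =
      a *: (x - int_vec R v) + b *: (y - int_vec R v).
    by rewrite !scalerBr addrACA -opprD -scalerDl ab1 scale1r.
  by apply: coneD; exact: coneZ.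
by move=> z zp /=; rewrite -int_vecB; exact: Sv.
Qed.

Section Vertex.
Variables (v : 'cV[int]_3) (f : 'rV[R]_3).
Hypothesis v_pos : pos L s v.
Hypothesis v_min : forall z, pos L s z -> z <> v ->
  pairing f (int_vec R v) < pairing f (int_vec R z).

Let iv := int_vec R v.

(** Strict minimality on lattice points passes to the hull because all of [K] lies in [v] plus a
    finitely generated cone on which [f] is positive away from the origin. *)
Lemma exposed_vertex : is_vertex K iv.
Proof.
have [B [BX BC]] := lattice_cone v_pos v_min.
have fB : {in [seq int_vec R (b - v) | b <- B], forall t, 0 < pairing f t}.
  move=> _ /mapP[b /BX[bp bv] ->].
  by rewrite int_vecB pairingBr subr_gt0 v_min.
have KB := klein_sub_tangent BC.
exists f; apply/seteqP; split=> [_ ->|x [Kx xv]] /=.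
  split=> [|y Ky]; first exact: klein_mem.
  rewrite -subr_ge0 -!/(pairing _ _) -pairingBr.
  by apply: cone_ge0 (KB _ Ky) => t /fB/ltW.
apply/eqP; rewrite -subr_eq0; apply/negP => /negP xv0.
have := cone_mulr_gt0 fB (KB _ Kx) xv0; rewrite pairingBr subr_gt0 ltNge.
by rewrite /pairing xv //; exact: klein_mem.
Qed.

(** The edge directions are those of an irredundant set of generators of the tangent cone, each
    replaced by the primitive vector on its ray. *)
Lemma edge_star : exists rs : seq 'cV[int]_3, [/\
  forall r, edge_vectors K iv r <-> r \in rs,
  {in rs, forall r, pos L s (v + r)},
  {in rs, forall r, 0 < pairing f (int_vec R r)} &
  forall z, pos L s z -> cone [seq int_vec R r | r <- rs] (int_vec R (z - v))].
Proof.
have [B [BX BC]] := lattice_cone v_pos v_min.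
have [S [SB BS irr]] := irredundant_subset [seq int_vec R (b - v) | b <- B].
have SC z : pos L s z -> cone S (int_vec R (z - v)).
  by move=> zp; apply: cone_trans (BC z zp) => t; exact: BS.
have KS := klein_sub_tangent SC.
have SX t : t \in S -> exists2 b, pos L s b & t = int_vec R (b - v) /\ b <> v.
  by move=> /SB/mapP[b /BX[bp bv] ->]; exists b.
have fS : {in S, forall t, 0 < pairing f t}.
  by move=> t /SX[b bp [-> bv]]; rewrite int_vecB pairingBr subr_gt0 v_min.
(* If [b - v = m r] with [m >= 1], then [m (v + r) = b + (m - 1) v], so [v + r] stays in the open
   cone. Outside [S] the value 0 is a dummy. *)
have /choice[p pP] (t : 'cV[R]_3) : exists r, t \in S ->
    [/\ primitive r, pos L s (v + r) & exists2 m, 0 < m & t = m *: int_vec R r].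
  have [tS|//] := boolP (t \in S); last by exists 0.
  have [b bp [tE bv]] := SX t tS.
  have [|r [m [rp m0 bE]]] := @primitive_part _ (b - v).
    by rewrite subr_eq0; apply/eqP.
  have m0R : 0 < m%:R :> R by rewrite ltr0n.
  exists r => _; split=> //; last by exists m%:R => //; rewrite tE bE int_vecMn.
  move=> i; rewrite -(pmulr_rgt0 _ m0R) -sformZ.
  have -> : m%:R *: int_vec R (v + r) = int_vec R b + (m%:R - 1) *: int_vec R v.
    rewrite -int_vecMn mulrnDl -bE int_vecD int_vecB int_vecMn scalerBl scale1r.
    by rewrite addrC -!addrA; congr (_ + _); rewrite addrC.
  have bi := bp i; rewrite sformD sformZ ltr_pwDl //.
  by rewrite mulr_ge0 ?subr_ge0 ?ler1n //; exact/ltW/v_pos.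
exists (map p S); split.
- move=> r; split.
    move=> [rp [E [[[g EE] [p0 [q [pq Ep Eq El]]]] Ev [t t0 Et]]]].
    have gS : {in S, forall u, 0 <= pairing g u}.
      move=> u /SX[b bp [-> _]]; rewrite int_vecB pairingBr subr_ge0.
      by move: Ev; rewrite EE => -[_]; apply; exact: klein_mem.
    have [Kt gt] : K (iv + t *: int_vec R r) /\
        pairing g (iv + t *: int_vec R r) <= pairing g iv.
      move: Et Ev; rewrite EE => -[Kt Et] [Kv _].
      by split=> //; exact: Et.
    have trS : cone S (t *: int_vec R r) by have := KS _ Kt; rewrite addrC addKr.
    have tr0 : t *: int_vec R r != 0.
      by rewrite scaler_eq0 gt_eqF //= int_vec_eq0 primitive_neq0.
    have ftr := cone_mulr_gt0 fS trS tr0.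
    (* The edge direction lies in the face of the tangent cone where [g] vanishes; being nonzero, it
       needs a generator [u] there, and then [v + u] is on the edge. *)
    have := @cone_face _ _ S g _ gS trS.
    rewrite -(lerD2l (pairing g iv)) addr0 -pairingDr => /(_ gt).
    case E0 : [seq _ <- _ | _] => [|u S0] => [/eqP|_]; first by rewrite (negPf tr0).
    have : u \in [seq u <- S | pairing g u == 0] by rewrite E0 mem_head.
    rewrite mem_filter => /andP[/eqP gu uS].
    have Eu : E (iv + u).
      move: Ev; rewrite EE => -[_ Ev]; split.
        have [b bp [-> _]] := SX u uS; rewrite int_vecB addrC subrK.
        exact: klein_mem.
      move=> y Ky; rewrite -/(pairing _ _) pairingDr gu addr0; exact: Ev.
    (* Three points of one line make [r] and [u] proportional; the factor is positive because [f] is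
       positive on both. *)
    have [k0 _ k0E] := El _ Ev; have [k1 _ k1E] := El _ Et.
    have [k2 _ k2E] := El _ Eu.
    have trE : t *: int_vec R r = (k1 - k0) *: (q - p0).
      by rewrite scalerBl -(addrKA p0) ![_ *: _ + p0]addrC k1E k0E addrC addKr.
    have uE : u = (k2 - k0) *: (q - p0).
      by rewrite scalerBl -(addrKA p0) ![_ *: _ + p0]addrC k2E k0E addrC addKr.
    have fu := fS u uS.
    have [pr _ [m m0 um]] := pP u uS.
    suff -> : r = p u by exact: map_f.
    have d0 : pairing f (q - p0) != 0.
      by move: fu; rewrite uE pairingZr; apply: contraTneq => ->; rewrite mulr0 ltxx.
    have k20 : k2 - k0 != 0.
      by move: fu; rewrite uE pairingZr; apply: contraTneq => ->; rewrite mul0r ltxx.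
    have quot : 0 < (k1 - k0) / (k2 - k0).
      rewrite -(@ltr_pM2r _ (pairing f u)) // mul0r uE pairingZr.
      by rewrite mulrA divfK // -pairingZr -trE.
    apply: (@primitive_ray _ R r (p u) (t^-1 * ((k1 - k0) / (k2 - k0) * m))) => //.
      by rewrite mulr_gt0 ?invr_gt0 // mulr_gt0.
    by rewrite -!scalerA -um uE scalerK // -trE scalerK // gt_eqF.
  move=> /mapP[u uS ->]; have [pr pp [m m0 um]] := pP u uS; split=> //.
  (* Conversely, a functional exposing the ray of [u] cuts out a face contained in the line through
     [v] and [v + u]. *)
  have [g [gu gS]] := exposed_ray fS uS (irr u uS).
  have gS0 : {in S, forall t, 0 <= pairing g t}.
    move=> t; rewrite (perm_mem (perm_to_rem uS)) in_cons => /orP[/eqP->|/gS/ltW//].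
    by rewrite gu.
  have Kmin y : K y -> pairing g iv <= pairing g y.
    move=> /KS/(cone_ge0 gS0); by rewrite pairingBr subr_ge0.
  have Kv : K iv by exact: klein_mem.
  have Kvu : K (iv + u).
    have [b bp [-> _]] := SX u uS; rewrite int_vecB addrC subrK; exact: klein_mem.
  pose E := [set x | K x /\ forall y, K y -> (g *m x) 0 0 <= (g *m y) 0 0].
  have Ev : E iv by [].
  have Eu : E (iv + u).
    split=> // y Ky; rewrite -/(pairing _ _) pairingDr gu addr0; exact: Kmin.
  exists E; split=> //; last by exists m; rewrite -?um.
  split; first by exists g.
  exists iv, (iv + u); split=> //.
    rewrite -subr_eq0 opprD addNKr oppr_eq0.
    by apply: contraTneq (fS u uS) => ->; rewrite pairing0r ltxx.
  move=> x [Kx Ex] /=.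
  have := cone_face gS0 (KS _ Kx).
  rewrite pairingBr subr_le0 => /(_ (Ex _ Kv)).
  have : all (pred1 u) [seq t <- S | pairing g t == 0].
    apply/allP => t; rewrite mem_filter => /andP[/eqP gt].
    rewrite (perm_mem (perm_to_rem uS)) in_cons => /orP[//|/gS].
    by rewrite gt ltxx.
  elim: [seq _ <- _ | _] (x) => [y _ /= /eqP|t T IH y /= /andP[/eqP-> Tu] [c _]].
    by rewrite subr_eq0 => /eqP ->; exists 0; rewrite // scale0r addr0.
  rewrite addrAC => /(IH _ Tu)[d _ dE]; exists (d + c) => //.
  apply/eqP; rewrite -subr_eq0 -[y](subrK (c *: u)) -dE.
  by rewrite [iv + u]addrC addrK scalerDl addrA subrr.
- by move=> _ /mapP[u /pP[_ ? _] ->].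
- move=> _ /mapP[u uS ->]; have [_ _ [m m0 um]] := pP u uS.
  by have := fS u uS; rewrite {1}um pairingZr pmulr_rgt0.
- move=> z zp; apply: cone_trans (SC z zp) => t tS.
  have [_ _ [m m0 ->]] := pP t tS; apply: coneZ; first exact: ltW.
  by apply: mem_cone; apply: map_f; exact: map_f.
Qed.

End Vertex.
End Klein.

(** Strict signs at [v] determine its closed cone; this identifies the sign vector quantified
    existentially in [star_vectors]. *)
Lemma klein_vertex_sign (R : realType) (L : 'M[R]_3) (s s' : {ffun 'I_3 -> bool})
    (L_irr : forall (z : 'cV[int]_3) (i : 'I_3),
      z != 0 -> (L *m int_vec R z) i 0 != 0) (v : 'cV[int]_3) :
  pos L s v -> klein_polyhedron L s' (int_vec R v) -> s' = s.
Proof.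
move=> vp /(klein_cone_sub L_irr) vs; apply/ffunP => i.
have := vs i; have := vp i; rewrite /sform.
by case: (s i); case: (s' i); rewrite // ?expr1 ?expr0 !(mulN1r, mul1r); lra.
Qed.

(** * Lower bounds for the determinant of a star *)

Lemma det3_cols (R : realType) (r1 r2 r3 : 'cV[int]_3) :
  (det3 r1 r2 r3)%:~R = det_cols (int_vec R r1) (int_vec R r2) (int_vec R r3).
Proof.
rewrite /det3 -/(det_cols r1 r2 r3) !det_colsE !mxE.
by rewrite !(intrD, intrB, intrM, mulrNz).
Qed.

Lemma absz_det3C12 r1 r2 r3 : `|det3 r2 r1 r3| = `|det3 r1 r2 r3|.
Proof.
rewrite /det3 -/(det_cols r2 r1 r3) -/(det_cols r1 r2 r3) -normrN.
by congr `| _ |; rewrite !det_colsE; ring.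
Qed.

Lemma absz_det3C23 r1 r2 r3 : `|det3 r1 r3 r2| = `|det3 r1 r2 r3|.
Proof.
rewrite /det3 -/(det_cols r1 r3 r2) -/(det_cols r1 r2 r3) -normrN.
by congr `| _ |; rewrite !det_colsE; ring.
Qed.

Lemma det3_rr r1 r3 : det3 r1 r1 r3 = 0.
Proof. by rewrite /det3 -/(det_cols r1 r1 r3) det_colsE; ring. Qed.

(** The absolute determinant is symmetric, so the three vectors may be sorted by their index in the
    enumeration; if two coincide it is 0, and otherwise it is one of the nonnegative summands. *)
Lemma det_star_ge (R : realType) (L : 'M[R]_3) v r1 r2 r3 :
  finite_set (star_vectors L v) -> star_vectors L v r1 -> star_vectors L v r2 ->
  star_vectors L v r3 -> `|det3 r1 r2 r3| <= det_star L v.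
Proof.
move=> fin /mem_set + /mem_set + /mem_set.
rewrite -!(in_fset_set fin) /det_star; set rs := enum_fset _.
rewrite -![_ \in fset_set _]/(_ \in rs) => h1 h2 h3.
set S := \sum_(_ < _) _.
have S0 : 0 <= S.
  by apply: sumr_ge0 => i _; apply: sumr_ge0 => j _; apply: sumr_ge0.
wlog i12 : r1 r2 r3 h1 h2 h3 / (index r1 rs <= index r2 rs)%N.
  move=> W; case/orP: (leq_total (index r1 rs) (index r2 rs)); first exact: W.
  by rewrite -absz_det3C12; exact: W.
wlog i23 : r1 r2 r3 h1 h2 h3 i12 / (index r2 rs <= index r3 rs)%N.
  move=> W; case/orP: (leq_total (index r2 rs) (index r3 rs)); first exact: W.
  rewrite -absz_det3C23 => i32.
  case/orP: (leq_total (index r1 rs) (index r3 rs)) => i13; first exact: W.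
  by rewrite -absz_det3C12; exact: W.
have [<-|n12] := eqVneq r1 r2; first by rewrite det3_rr normr0.
have [<-|n23] := eqVneq r2 r3.
  by rewrite -absz_det3C12 -absz_det3C23 det3_rr normr0.
have idx r r' : r \in rs -> r' \in rs -> r != r' ->
    (index r rs <= index r' rs)%N -> (index r rs < index r' rs)%N.
  move=> hr hr' nr; rewrite leq_eqVlt => /orP[/eqP e|//].
  by move: nr; rewrite -(nth_index 0 hr) e nth_index // eqxx.
have I1 : (index r1 rs < size rs)%N by rewrite index_mem.
have I2 : (index r2 rs < size rs)%N by rewrite index_mem.
have I3 : (index r3 rs < size rs)%N by rewrite index_mem.
rewrite /S (bigD1 (Ordinal I1)) //= (bigD1 (Ordinal I2)) /= ?idx //.
rewrite (bigD1 (Ordinal I3)) /= ?idx // !nth_index // -!addrA lerDl.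
rewrite !addr_ge0 //; repeat (apply: sumr_ge0 => ? _ //).
Qed.

Lemma det_cols_bound (R : realType) (a b c : 'cV[R]_3) (x : 'I_3 -> R) (A B C : R) :
  (forall i, `|a i 0| <= A * x i) -> (forall i, `|b i 0| <= B * x i) ->
  (forall i, `|c i 0| <= C * x i) ->
  `|det_cols a b c| <= 6 * (A * B * C) * \prod_i x i.
Proof.
move=> ha hb hc; rewrite big_ord3 /= det_colsE.
have t i j k : `|a i 0 * b j 0 * c k 0| <= A * x i * (B * x j) * (C * x k).
  by rewrite !normrM !ler_pM ?mulr_ge0.
move: (t 0 1 2) (t 0 2 1) (t 1 0 2) (t 1 2 0) (t 2 0 1) (t 2 1 0).
rewrite !ler_norml => /andP[? ?] /andP[? ?] /andP[? ?] /andP[? ?] /andP[? ?].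
by move=> /andP[? ?]; lra.
Qed.

(** * Heights of edge vectors bounded by determinants of the star *)

Section StarBound.
Variables (R : realType) (L : 'M[R]_3) (s : {ffun 'I_3 -> bool}).
Implicit Types (z v r : 'cV[int]_3) (f : 'rV[R]_3).

(** As [v] is interior to the cone, a large multiple of it absorbs [z]; the sum of the
    coordinatewise bounds serves all coordinates. *)
Lemma pos_shift v z : pos L s v -> exists n, pos L s (z + v *+ n.+1).
Proof.
move=> vp; pose k i := Num.truncn (`|sform L s (int_vec R z) i| /
  sform L s (int_vec R v) i).
exists (\sum_i k i)%N => i; rewrite int_vecD int_vecMn sformD sformZ.
have : `|sform L s (int_vec R z) i| <
    (k i).+1%:R * sform L s (int_vec R v) i.
  by rewrite -ltr_pdivrMr //; exact: truncnS_gt.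
have : (k i).+1%:R * sform L s (int_vec R v) i <=
    (\sum_i k i).+1%:R * sform L s (int_vec R v) i.
  by rewrite ler_pM2r // ler_nat ltnS (bigD1 i) //= leq_addr.
have := ler_norm (- sform L s (int_vec R z) i); rewrite normrN; lra.
Qed.

Lemma cone_closed (S : seq 'cV[R]_3) (P : 'cV[R]_3 -> Prop) :
  P 0 -> (forall x y, P x -> P y -> P (x + y)) ->
  (forall a x, P x -> P (a *: x)) -> {in S, forall t, P t} ->
  forall x, cone S x -> P x.
Proof.
move=> P0 PD PZ; elim: S => [_ x ->//|t S IH PS x [c c0 xS]].
rewrite -(subrK (c *: t) x); apply: PD; last by apply/PZ/PS; rewrite mem_head.
by apply: IH xS => u uS; apply: PS; rewrite in_cons uS orbT.
Qed.

Variables (v : 'cV[int]_3) (f : 'rV[R]_3) (rs : seq 'cV[int]_3).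
Hypothesis v_pos : pos L s v.
Hypothesis f_gt0 : {in rs, forall r, 0 < pairing f (int_vec R r)}.
Hypothesis rs_cone :
  forall z, pos L s z -> cone [seq int_vec R r | r <- rs] (int_vec R (z - v)).

Lemma star_cone z : pos L s z -> cone [seq int_vec R r | r <- rs] (int_vec R z).
Proof. by move=> zp; rewrite -[z](addrK v); apply: rs_cone; exact: posD. Qed.

(** Every integer vector is a difference of two lattice points of the open cone, both of which are
    combinations of [rs]. So a linear condition on [rs] holds at all integer vectors. *)
Lemma star_span (P : 'cV[R]_3 -> Prop) :
  P 0 -> (forall x y, P x -> P y -> P (x + y)) ->
  (forall a x, P x -> P (a *: x)) -> {in rs, forall r, P (int_vec R r)} ->
  forall z, P (int_vec R z).
Proof.
move=> P0 PD PZ Prs z.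
have cP x : cone [seq int_vec R r | r <- rs] x -> P x.
  by apply: cone_closed => // _ /mapP[r /Prs ? ->].
have [n zn] := pos_shift z v_pos.
rewrite -(addrK (v *+ n.+1) z) int_vecB int_vecMn -scaleNr; apply: PD.
  by apply/cP/star_cone.
by apply/PZ/cP/star_cone.
Qed.

(** If all these determinants vanished, multilinearity would extend this to all pairs of integer
    vectors; pairs of unit vectors then give [a = 0]. *)
Lemma star_basis a : a != 0 -> exists j k, [/\ j \in rs, k \in rs &
  det_cols (int_vec R a) (int_vec R j) (int_vec R k) != 0].
Proof.
move=> a0; apply: contrapT => nD.
have D0 : {in rs &, forall j k,
    det_cols (int_vec R a) (int_vec R j) (int_vec R k) = 0}.
  move=> j k jr kr; apply/eqP/negP => /negP D; apply: nD; by exists j, k.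
have D1 j z : j \in rs -> det_cols (int_vec R a) (int_vec R j) (int_vec R z) = 0.
  move=> jr; pose P x := det_cols (int_vec R a) (int_vec R j) x = 0.
  apply: (@star_span P); rewrite /P.
  - by rewrite det_colsE !mxE; ring.
  - move=> x y hx hy; transitivity (det_cols (int_vec R a) (int_vec R j) x +
      det_cols (int_vec R a) (int_vec R j) y); last by rewrite hx hy addr0.
    by rewrite !det_colsE !mxE; ring.
  - move=> c x hx; transitivity (c * det_cols (int_vec R a) (int_vec R j) x).
      by rewrite !det_colsE !mxE; ring.
    by rewrite hx mulr0.
  - by move=> k; exact: D0.
have D2 z z' : det_cols (int_vec R a) (int_vec R z) (int_vec R z') = 0.
  pose P x := det_cols (int_vec R a) x (int_vec R z') = 0.
  apply: (@star_span P); rewrite /P.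
  - by rewrite det_colsE !mxE; ring.
  - move=> x y hx hy; transitivity (det_cols (int_vec R a) x (int_vec R z') +
      det_cols (int_vec R a) y (int_vec R z')); last by rewrite hx hy addr0.
    by rewrite !det_colsE !mxE; ring.
  - move=> c x hx; transitivity (c * det_cols (int_vec R a) x (int_vec R z')).
      by rewrite !det_colsE !mxE; ring.
    by rewrite hx mulr0.
  - by move=> k kr; exact: D1.
move/eqP: a0; apply; apply: (@int_vec_inj R); rewrite int_vec0.
apply: cV3P; rewrite [RHS]mxE.
- by have := D2 (delta_mx 1 0) (delta_mx 2 0); rewrite det_colsE !mxE /=; lra.
- by have := D2 (delta_mx 0 0) (delta_mx 2 0); rewrite det_colsE !mxE /=; lra.
- by have := D2 (delta_mx 0 0) (delta_mx 1 0); rewrite det_colsE !mxE /=; lra.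
Qed.

Lemma star_triple a : a \in rs -> exists j k, [/\ j \in rs, k \in rs &
  pairing f (int_vec R a) <= pairing f (int_vec R v) * `|det3 a j k|%:~R].
Proof.
move=> ars; have fa := f_gt0 ars.
have a0 : a != 0 by apply: contraTneq fa => ->; rewrite int_vec0 pairing0r ltxx.
pose T := [seq int_vec R r | r <- rs].
(* Since [(n + 1) v - a] is in the cone, [v] is [a / (n + 1)] plus a combination of edge vectors:
   this is the positive coefficient of [a] to be preserved. *)
have [n np] := pos_shift (- a) v_pos.
have fT : {in T, forall t, 0 < pairing f t} by move=> _ /mapP[r rr ->]; exact: f_gt0.
have aT : int_vec R a \in T by exact: map_f.
have [j0 [k0 [j0r k0r D0]]] := star_basis a0.
have n0 : 0 < n.+1%:R^-1 :> R by rewrite invr_gt0.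
have vT : cone T (int_vec R v - n.+1%:R^-1 *: int_vec R a).
  have -> : int_vec R v - n.+1%:R^-1 *: int_vec R a =
      n.+1%:R^-1 *: int_vec R (- a + v *+ n.+1).
    by rewrite [- a + _]addrC int_vecB int_vecMn scalerBr scalerA mulVf ?scale1r //.
  by apply: coneZ; [exact: ltW|exact: star_cone].
have [||j [k [al [be [ga [jT kT D [al0 be0 ga0] vE]]]]]] :=
  @caratheodory3 R f T T (int_vec R a) (int_vec R v) _ fT aT _ _ n0 vT.
- by [].
- by exists (int_vec R j0), (int_vec R k0); split=> //; exact: map_f.
have [j' j'r jE] := mapP jT; have [k' k'r kE] := mapP kT.
exists j', k'; split=> //.
have Dv : det_cols (int_vec R v) (int_vec R j') (int_vec R k') =
    al * det_cols (int_vec R a) (int_vec R j') (int_vec R k').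
  by rewrite vE jE kE det_cols_lin1.
(* A nonzero integer has absolute value at least 1. *)
have one : 1 <= `|(det3 v j' k')%:~R| :> R.
  rewrite -intr_norm ler1z -gtz0_ge1 normr_gt0 -(intr_eq0 R) det3_cols Dv.
  by rewrite mulf_neq0 ?(gt_eqF al0) // -jE -kE.
rewrite intr_norm; move: one; rewrite !det3_cols Dv normrM (gtr0_norm al0).
set d := `|_| => one.
have fv : al * pairing f (int_vec R a) <= pairing f (int_vec R v).
  rewrite [in leRHS]vE !pairingDr !pairingZr -addrA lerDl addr_ge0 // mulr_ge0 //.
    exact/ltW/fT.
  exact/ltW/fT.
apply: (@le_trans _ _ (al * pairing f (int_vec R a) * d)).
  by rewrite mulrAC ler_peMl // ltW.
by rewrite ler_wpM2r // normr_ge0.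
Qed.

End StarBound.

(** * A vertex near a given lattice point *)

Lemma finite_int_box n (N : nat) :
  finite_set [set z : 'cV[int]_n | forall i, (`|z i 0%R| <= N)%N].
Proof.
pose h (g : {ffun 'I_n -> 'I_(N + N).+1}) : 'cV[int]_n := \col_i (g i)%:Z - const_mx N%:Z.
apply: (@sub_finite_set _ _ [set h g | g in [set: {ffun 'I_n -> 'I_(N + N).+1}]]).
  move=> z zN; exists [ffun i => inord `|z i 0%R + N%:Z|] => //.
  apply/matrixP => i j; rewrite !mxE ffunE (ord1 j).
  have := zN i => zi; rewrite inordK; lia.
exact/finite_image/finite_finset.
Qed.

Section Bounds.
Variables (R : realType).

Lemma mx_entry_le_norm m n (x : 'M[R]_(m.+1, n.+1)) i j : `|x i j| <= `|x|.
Proof.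
rewrite /Num.norm /= mx_normrE.
by apply: (@le_bigmax _ _ _ _ (fun ij => `|x ij.1 ij.2|) (i, j)).
Qed.

Lemma mx_norm_le m n (x : 'M[R]_(m.+1, n.+1)) c :
  0 <= c -> (forall i j, `|x i j| <= c) -> `|x| <= c.
Proof.
move=> c0 xc; rewrite /Num.norm /= mx_normrE.
by apply/bigmax_leP; split=> // -[i j] _; exact: xc.
Qed.

Lemma mulmx_norm_le m n (A : 'M[R]_(m.+1, n.+1)) :
  exists2 C, 0 < C & forall x : 'cV[R]_n.+1, `|A *m x| <= C * `|x|.
Proof.
(* The summand 1 keeps the constant positive when [A] is 0. *)
exists (1 + n.+1%:R * `|A|); first by rewrite ltr_pwDl // mulr_ge0.
move=> x; apply: mx_norm_le => [|i j]; first by rewrite mulr_ge0 // addr_ge0 ?mulr_ge0.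
rewrite mxE (le_trans (ler_norm_sum _ _ _)) //.
apply: (@le_trans _ _ (\sum_(k < n.+1) `|A| * `|x|)).
  by apply: ler_sum => k _; rewrite normrM ler_pM // mx_entry_le_norm.
rewrite sumr_const card_ord -[leLHS]mulr_natl mulrA ler_wpM2r //.
by rewrite lerDr.
Qed.

End Bounds.

(** * Minimising a sum of square roots over the lattice points of a cone *)

Section GoodVertex.
Variables (R : realType) (L : 'M[R]_3).
Hypothesis L_unit : L \in unitmx.
Hypothesis L_irr : forall (z : 'cV[int]_3) (i : 'I_3),
  z != 0 -> (L *m int_vec R z) i 0 != 0.

Lemma int_vec_norm_le n (z : 'cV[int]_n.+1) c :
  `|int_vec R z| <= c -> forall i, (`|z i 0%R| <= Num.truncn c)%N.
Proof.
move=> zc i; have := le_trans (mx_entry_le_norm (int_vec R z) i 0) zc.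
rewrite mxE -intr_norm -natr_absz => zi.
by rewrite truncn_ge_nat // (le_trans _ zi).
Qed.

Lemma finite_int_ball n c :
  finite_set [set z : 'cV[int]_n.+1 | `|int_vec R z| <= c].
Proof.
apply: sub_finite_set (finite_int_box n.+1 (Num.truncn c)) => z /=.
exact: int_vec_norm_le.
Qed.

Lemma form_norm_ge : exists2 C, 0 < C &
  forall z : 'cV[int]_3, `|int_vec R z| <= C * `|L *m int_vec R z|.
Proof.
have [C C0 CP] := mulmx_norm_le (invmx L).
by exists C => // z; have := CP (L *m int_vec R z); rewrite mulKmx.
Qed.

Lemma seq_argmin (T : eqType) (S : seq T) (P : T -> Prop) (phi : T -> R) x :
  x \in S -> P x ->
  exists v, P v /\ forall y, y \in S -> P y -> phi v <= phi y.
Proof.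
elim: S x => // t S IH x xS Px.
have [[y [yS Py]]|nS] := pselect (exists y, y \in S /\ P y); last first.
  exists x; split=> // y; rewrite in_cons => /orP[/eqP->|yS Py]; last first.
    by case: nS; exists y.
  move: xS; rewrite in_cons => /orP[/eqP->//|xS].
  by case: nS; exists x.
have [v [Pv vmin]] := IH y yS Py.
have [[Pt tv]|ntv] := pselect (P t /\ phi t <= phi v).
  exists t; split=> // u; rewrite in_cons => /orP[/eqP->//|uS Pu].
  exact: le_trans tv (vmin u uS Pu).
exists v; split=> // u; rewrite in_cons => /orP[/eqP-> Pt|]; last exact: vmin.
by rewrite leNgt; apply/negP => tv; apply: ntv; split=> //; exact: ltW.
Qed.

Lemma exposed_point (s : {ffun 'I_3 -> bool}) z0 : pos L s z0 ->
  exists v (f : 'rV[R]_3) (q : 'I_3 -> R),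
    [/\ pos L s v, forall i, 0 < q i, forall i, q i <= 3 /\
      sform L s (int_vec R v) i = q i ^+ 2 * sform L s (int_vec R z0) i,
      forall y, pairing f y = \sum_i sform L s y i / (sform L s (int_vec R z0) i * q i)
    & forall z, pos L s z -> z <> v ->
      pairing f (int_vec R v) < pairing f (int_vec R z)].
Proof.
move=> z0p; pose x i := sform L s (int_vec R z0) i.
have x0 i : 0 < x i by exact: z0p.
pose q z i := Num.sqrt (sform L s (int_vec R z) i / x i).
have qE z i : pos L s z -> sform L s (int_vec R z) i = q z i ^+ 2 * x i.
  by move=> zp; rewrite sqr_sqrtr ?divfK ?gt_eqF // divr_ge0 // ltW.
have q0 z i : pos L s z -> 0 < q z i.
  by move=> zp; rewrite sqrtr_gt0 divr_gt0.
pose phi z := q z 0 + q z 1 + q z 2.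
have qz0 i : q z0 i = 1 by rewrite /q divff ?gt_eqF // sqrtr1.
have [C C0 CP] := form_norm_ge.
(* The starting point has [phi z0 = 3]. Where [phi <= 3], each [q z i] is at most 3, so each signed
   form is at most [9 * x i]; only finitely many lattice points satisfy this. *)
pose N := 9 * (x 0 + x 1 + x 2).
have /finite_seqP[S SE] := finite_int_ball 2 (C * N).
have xN i : 9 * x i <= N.
  by move: i; apply: ord3P; rewrite ler_wpM2l //;
     have := x0 0; have := x0 1; have := x0 2; lra.
have N0 : 0 <= N by rewrite (le_trans _ (xN 0)) // mulr_ge0 // ltW.
have memS z : pos L s z -> phi z <= 3 -> z \in S /\ forall i, q z i <= 3.
  move=> zp zphi.
  have q3 i : q z i <= 3.
    move: i; apply: ord3P; move: zphi; rewrite /phi;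
      have := q0 z 0 zp; have := q0 z 1 zp; have := q0 z 2 zp; lra.
  split=> //; suff : [set` S] z by [].
  rewrite -SE /= (le_trans (CP z)) // ler_wpM2l ?(ltW C0) //.
  apply: mx_norm_le => // i j; rewrite (ord1 j).
  have -> : `|(L *m int_vec R z) i 0| = sform L s (int_vec R z) i.
    by rewrite -(gtr0_norm (zp i)) /sform normrM normr_sign mul1r.
  rewrite qE // (le_trans _ (xN i)) // ler_wpM2r ?(ltW (x0 i)) //.
  by have := q3 i; have := q0 z i zp; nra.
have z0phi : phi z0 <= 3 by rewrite /phi !qz0; lra.
have [z0S _] := memS z0 z0p z0phi.
have [v [vp vmin]] := seq_argmin phi z0S z0p.
have vphi : phi v <= 3 by apply: le_trans (vmin _ z0S z0p) _.
have vmin' y : pos L s y -> phi v <= phi y.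
  move=> yp; have [y3|/ltW y3] := leP (phi y) 3; last exact: le_trans y3.
  by apply: vmin => //; have [] := memS y yp y3.
(* Twice the gradient at [v] of the function minimised. *)
pose f := \sum_i ((-1) ^+ s i / (x i * q v i)) *: row i L.
have fE y : pairing f y = \sum_i sform L s y i / (x i * q v i).
  rewrite /pairing mulmx_suml summxE; apply: eq_bigr => i _.
  by rewrite -scalemxAl mxE -row_mul mxE /sform mulrAC.
exists v, f, (q v); split=> //.
- by move=> i; exact: q0.
- by move=> i; rewrite -qE //; split=> //; have [_] := memS v vp vphi.
move=> z zp zv; rewrite !fE !big_ord3 /=.
have term y i : pos L s y -> sform L s (int_vec R y) i / (x i * q v i) =
    q y i ^+ 2 / q v i.
  by move=> yp; rewrite qE // invfM mulrA mulfK // gt_eqF.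
rewrite !term //.
(* The tangent inequality of the square root, with the square [(q z i - q v i) ^+ 2] as defect.
   Summed over [i], it gives [f z - f v >= 2 (phi z - phi v) >= 0]. *)
have conc i : q v i ^+ 2 / q v i + 2 * (q z i - q v i) <= q z i ^+ 2 / q v i
    ?= iff (q z i == q v i).
  have qv0 := q0 v i vp; rewrite /Num.leif.
  have -> : q z i ^+ 2 / q v i = q v i ^+ 2 / q v i + 2 * (q z i - q v i)
      + (q z i - q v i) ^+ 2 / q v i by field; rewrite gt_eqF.
  split; first by rewrite lerDl divr_ge0 ?sqr_ge0 // ltW.
  by rewrite -[X in X == _]addr0 (inj_eq (addrI _)) eq_sym mulf_eq0 invr_eq0 (gt_eqF qv0) orbF
    sqrf_eq0 subr_eq0.
have [c0 e0] := conc 0; have [c1 e1] := conc 1; have [c2 e2] := conc 2.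
have := vmin' z zp; rewrite /phi => ph.
have le : q v 0 ^+ 2 / q v 0 + q v 1 ^+ 2 / q v 1 + q v 2 ^+ 2 / q v 2 <=
    q z 0 ^+ 2 / q v 0 + q z 1 ^+ 2 / q v 1 + q z 2 ^+ 2 / q v 2 by lra.
rewrite lt_neqAle le andbT; apply/negP => /eqP eq.
have h0 : q z 0 = q v 0 by apply/eqP; rewrite -e0; apply/eqP; lra.
have h1 : q z 1 = q v 1 by apply/eqP; rewrite -e1; apply/eqP; lra.
(* In case of equality a form vanishes at the integer point [z - v], so [z = v]. *)
apply/zv/eqP; rewrite -subr_eq0; apply/negP => /negP /L_irr - /(_ 0).
have : sform L s (int_vec R (z - v)) 0 = 0.
  by rewrite int_vecB sformB !qE // h0 subrr.
by rewrite /sform => /eqP; rewrite mulf_eq0 signr_eq0 /= => ->.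
Qed.

Lemma good_vertex z0 : z0 != 0 -> exists v : 'cV[int]_3,
  [/\ klein_vertices L (int_vec R v), v != 0,
    forall i, `|(L *m int_vec R v) i 0| <= 9 * `|(L *m int_vec R z0) i 0|,
    1 <= det_star L (int_vec R v) &
    `|\det L| <= 54 ^+ 3 * (det_star L (int_vec R v))%:~R ^+ 2 *
      \prod_i `|(L *m int_vec R z0) i 0|].
Proof.
move=> z0N; pose s := [ffun i => (L *m int_vec R z0) i 0 < 0].
have xE i : sform L s (int_vec R z0) i = `|(L *m int_vec R z0) i 0|.
  rewrite /sform ffunE; case: ltP => h; first by rewrite expr1 mulN1r ltr0_norm.
  by rewrite expr0 mul1r ger0_norm.
have z0p : pos L s z0 by move=> i; rewrite xE normr_gt0 L_irr.
have [v [f [q [vp q0 q3 fE vmin]]]] := exposed_point z0p.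
have [rs [rsE rsp rsf rsC]] := edge_star L_irr vp vmin.
have vV := exposed_vertex L_irr vp vmin.
have starE r : star_vectors L (int_vec R v) r <-> r \in rs.
  rewrite -rsE; split=> [[s' [g gE] E]|E]; last by exists s.
  suff <- : s' = s by [].
  apply: (klein_vertex_sign L_irr vp).
  by have : [set int_vec R v] (int_vec R v) by []; rewrite gE => -[].
have fin : finite_set (star_vectors L (int_vec R v)).
  by apply/finite_seqP; exists rs; apply/seteqP; split=> r /= /starE.
have normE z : pos L s z -> forall i,
    `|(L *m int_vec R z) i 0| = sform L s (int_vec R z) i.
  by move=> zp i; rewrite -(gtr0_norm (zp i)) /sform normrM normr_sign mul1r.
have [j [k [jr kr Djk]]] := star_basis vp rsC (pos_neq0 vp).
pose D : R := (det_star L (int_vec R v))%:~R.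
pose x i := `|(L *m int_vec R z0) i 0|.
have x0 i : 0 < x i by rewrite normr_gt0 L_irr.
have fv3 : pairing f (int_vec R v) = q 0 + q 1 + q 2.
  rewrite fE big_ord3 /=.
  have t i : sform L s (int_vec R v) i / (sform L s (int_vec R z0) i * q i) = q i.
    have [_ ->] := q3 i; have := q0 i; have := z0p i => h1 h2.
    by field; rewrite !gt_eqF.
  by rewrite !t.
have fv9 : pairing f (int_vec R v) <= 9.
  by rewrite fv3; have [? _] := q3 0; have [? _] := q3 1; have [? _] := q3 2; lra.
have fv0 : 0 < pairing f (int_vec R v).
  by rewrite fv3; have := q0 0; have := q0 1; have := q0 2; lra.
(* Here 9 bounds [f v], which is the sum of the three [q i <= 3]. *)
have frD r : r \in rs -> pairing f (int_vec R r) <= 9 * D.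
  move=> rr; have [j1 [k1 [j1r k1r /le_trans]]] := star_triple vp rsf rsC rr.
  apply; apply: ler_pM => //; first exact: ltW.
  by rewrite ler_int; apply: det_star_ge => //; exact/starE.
have D1 : 1 <= det_star L (int_vec R v).
  rewrite -gtz0_ge1 -(ltr0z R) -/D.
  by have := frD _ jr; have := rsf _ jr; lra.
have D1R : 1 <= D by rewrite ler1z.
have vx i : `|(L *m int_vec R v) i 0| <= 9 * x i.
  rewrite normE //; have [q3i ->] := q3 i; rewrite xE -/(x i) ler_wpM2r ?(ltW (x0 i)) //.
  by have := q0 i; nra.
have rx r : r \in rs -> forall i, `|(L *m int_vec R r) i 0| <= 54 * D * x i.
  move=> rr i; have -> : `|(L *m int_vec R r) i 0| = `|sform L s (int_vec R r) i|.
    by rewrite /sform normrM normr_sign mul1r.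
  have lb l : - sform L s (int_vec R v) l <= sform L s (int_vec R r) l.
    by have := rsp _ rr l; rewrite int_vecD sformD; lra.
  (* The three summands of [f r]. As [v + r] lies in the open cone, each is at least [- q l >= - 3],
     so an upper bound on the sum bounds each one from above. *)
  pose t l := sform L s (int_vec R r) l / (x l * q l).
  have tE l : sform L s (int_vec R r) l = t l * q l * x l.
    by rewrite /t; have := q0 l; have := x0 l => h1 h2; field; rewrite !gt_eqF.
  have tlb l : - q l <= t l.
    have := lb l; have [_ ->] := q3 l; rewrite xE -/(x l) tE.
    have := q0 l; have := x0 l => h1 h2.
    rewrite -mulNr ler_pM2r // => h.
    by rewrite -(ler_pM2r h2) mulNr -expr2.
  have fr := frD r rr.
  have tub : t i <= 9 * D + 9.
    have : t 0 + t 1 + t 2 <= 9 * D.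
      by move: fr; rewrite fE big_ord3 /= !xE.
    move: (tlb 0) (tlb 1) (tlb 2) (q3 0) (q3 1) (q3 2) (q0 0) (q0 1) (q0 2).
    move=> ? ? ? [? _] [? _] [? _] ? ? ? ?; move: i; apply: ord3P; lra.
  rewrite tE 2!normrM (gtr0_norm (q0 i)) (gtr0_norm (x0 i)) ler_wpM2r ?(ltW (x0 i)) //.
  have qi := q0 i; have [q3i _] := q3 i.
  (* The factor 3 bounds [q i], and [27 * D + 27 <= 54 * D] since [D >= 1]. *)
  apply: (@le_trans _ _ ((9 * D + 9) * 3)); last by lra.
  apply: ler_pM => //; first exact: ltW.
  by rewrite ler_norml tub andbT; have := tlb i; lra.
exists v; split=> //; [by exists s|exact: pos_neq0 vp|].
(* The constants multiply to [6 * 9 * (54 * D) ^ 2 = 54 ^ 3 * D ^ 2]. *)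
have := det_cols_bound vx (rx _ jr) (rx _ kr).
rewrite det_cols_mulmx normrM -det3_cols.
have : 1 <= `|(det3 v j k)%:~R| :> R.
  by rewrite -intr_norm ler1z -gtz0_ge1 normr_gt0 -(intr_eq0 R) det3_cols.
move=> d1 /(le_trans _) h.
apply: (le_trans (h _ _)); first by rewrite ler_peMr.
by rewrite le_eqVlt; apply/orP; left; apply/eqP; rewrite -/D; ring.
Qed.

End GoodVertex.

(** * The upper limit *)

Section Final.
Variables (R : realType) (L : 'M[R]_3).
Hypothesis L_unit : L \in unitmx.
Hypothesis L_irr : forall (z : 'cV[int]_3) (i : 'I_3),
  z != 0 -> (L *m int_vec R z) i 0 != 0.

(** Only finitely many nonzero integer points have norm at most [N], and no form vanishes at any of
    them. *)
Lemma small_form_large_norm (N : R) : exists2 del, 0 < del &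
  forall (v : 'cV[int]_3) i, v != 0 -> `|(L *m int_vec R v) i 0| < del ->
    N < `|int_vec R v|.
Proof.
have /finite_seqP[S SE] := finite_int_ball 2 N.
pose T := [seq (v, i) | v <- [seq v <- S | v != 0], i <- enum 'I_3].
have [|del del0 delT] := @positive_gap R _ T
    (fun vi => `|(L *m int_vec R vi.1) vi.2 0|).
  move=> _ /allpairsP[[v i] /= [vS _ ->]] /=; rewrite normr_gt0 L_irr //.
  by move: vS; rewrite mem_filter => /andP[].
exists del => // v i v0; rewrite !ltNge; apply: contra => vN.
apply: (delT (v, i)); apply/allpairsP; exists (v, i); rewrite mem_enum.
split=> //; rewrite mem_filter v0 /=.
by suff : [set` S] v by []; rewrite -SE.
Qed.

(* Dirichlet's pigeonhole on the points [(a, b, 0)] of a square. *)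
Lemma small_form del : 0 < del ->
  exists2 z : 'cV[int]_3, z != 0 & `|(L *m int_vec R z) 0 0| < del.
Proof.
move=> del0; apply: contrapT => nz.
have far z : z != 0 -> del <= `|(L *m int_vec R z) 0 0|.
  by move=> z0; rewrite leNgt; apply/negP => h; apply: nz; exists z.
pose l z := (L *m int_vec R z) 0 0.
have lB z z' : l (z - z') = l z - l z' by rewrite /l int_vecB mulmxBr !mxE.
pose e0 : 'cV[int]_3 := delta_mx 0 0; pose e1 : 'cV[int]_3 := delta_mx 1 0.
pose S := `|l e0| + `|l e1|.
have S0 : 0 <= S by rewrite addr_ge0.
(* On the grid the form takes values in an interval of length [2 n S < n ^ 2 del], which is covered
   by [n ^ 2 + 1] boxes of width [del]. *)
pose n := (Num.truncn (2 * S / del)).+1.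
have nS : 2 * S < n%:R * del by rewrite -ltr_pdivrMr //; exact: truncnS_gt.
pose pt (p : 'I_n.+1 * 'I_n.+1) := e0 *+ p.1 + e1 *+ p.2.
have lpt p : l (pt p) = p.1%:R * l e0 + p.2%:R * l e1.
  by rewrite /l /pt int_vecD !int_vecMn mulmxDr -!scalemxAr !mxE.
have ptS p : 0 <= l (pt p) + n%:R * S <= n%:R * (2 * S).
  have le0 : `|p.1%:R * l e0| <= n%:R * `|l e0|.
    by rewrite normrM ler_wpM2r // normr_nat ler_nat -ltnS ltn_ord.
  have le1 : `|p.2%:R * l e1| <= n%:R * `|l e1|.
    by rewrite normrM ler_wpM2r // normr_nat ler_nat -ltnS ltn_ord.
  move: le0 le1; rewrite lpt !ler_norml => /andP[? ?] /andP[? ?].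
  by rewrite /S; apply/andP; split; lra.
pose k p := Num.truncn ((l (pt p) + n%:R * S) / del).
have kn p : (k p < (n * n).+1)%N.
  have /andP[h1 h2] := ptS p.
  rewrite truncn_lt_nat ?divr_ge0 // 1?ltW // ltr_pdivrMr //.
  apply: (le_lt_trans h2); apply: (@le_lt_trans _ _ ((n * n)%:R * del)).
    by rewrite natrM -mulrA ler_wpM2l // ltW.
  by rewrite ltr_pM2r // ltr_nat.
pose K p := Ordinal (kn p).
have Kinj : injective K.
  move=> p p' /(congr1 val) /= kk.
  have [pp|npp] := eqVneq (pt p) (pt p').
    move/matrixP: pp => pp; have := pp 0 0; have := pp 1 0.
    rewrite /pt !(mulmxnE, mxE) /= !mul0rn !addr0 !add0r !natz => -[h1] [h0].
    by case: p p' h0 h1 {kk pp} => [a b] [a' b'] /= /val_inj-> /val_inj->.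
  have := far (pt p - pt p'); rewrite subr_eq0 -/(l _) lB => /(_ npp).
  rewrite leNgt => /negP[].
  have t z : 0 <= l (pt z) + n%:R * S ->
      (k z)%:R * del <= l (pt z) + n%:R * S < (k z)%:R * del + del.
    move=> h; have : 0 <= (l (pt z) + n%:R * S) / del by rewrite divr_ge0 // ltW.
    move=> /truncn_itv; rewrite -/(k z) -natr1 ler_pdivlMr // ltr_pdivrMr //.
    by rewrite mulrDl mul1r.
  have /andP[/t /andP[a1 a2] _] := ptS p; have /andP[/t /andP[b1 b2] _] := ptS p'.
  by move: a1 a2; rewrite kk ltr_norml => ? ?; apply/andP; split; lra.
(* [(n + 1) ^ 2] grid points exceed [n ^ 2 + 1] boxes because [n] is positive. *)
have := leq_card K Kinj; rewrite card_prod !card_ord; lia.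
Qed.

(** A lattice point with [P <= X ^ (- 3 gam)], where [P] is the product of the absolute forms and
    [X] the norm, yields a vertex with [D ^ 2 >= const / P] and norm at most a constant times [X];
    taking [X] large makes the constants cost at most [eta]. *)
Lemma vertex_ratio (gam N eta : R) : 0 < eta ->
  infinite_set [set x | form_lattice L x /\ Pi_mean x <= `|x| `^ (- gam)] ->
  exists v, [/\ klein_vertices L v, 1 < `|v|, N < `|v| &
    3 / 2 * gam - eta <= ln (det_star L v)%:~R / ln `|v|].
Proof.
move=> eta0 inf.
have [del del0 delP] := small_form_large_norm (Num.max 1 N).
have key z : z != 0 -> (exists i, `|(L *m int_vec R z) i 0| < del / 9) ->
    exists v : 'cV[int]_3, [/\ klein_vertices L (int_vec R v),
    1 < `|int_vec R v| /\ N < `|int_vec R v|,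
    `|L *m int_vec R v| <= 9 * `|L *m int_vec R z|, 1 <= det_star L (int_vec R v) &
    `|\det L| <= 54 ^+ 3 * (det_star L (int_vec R v))%:~R ^+ 2 *
      \prod_i `|(L *m int_vec R z) i 0| ].
  move=> z0 [i zi]; have [v [vV v0 vz D1 Dz]] := good_vertex L_unit L_irr z0.
  exists v; split=> //.
    have : Num.max 1 N < `|int_vec R v|.
      apply: (delP v i v0); apply: (le_lt_trans (vz i)); lra.
    by rewrite gt_max => /andP[].
  apply: mx_norm_le => [|a b]; first by rewrite mulr_ge0.
  by rewrite (ord1 b) (le_trans (vz a)) // ler_wpM2l // mx_entry_le_norm.
(* Here any vertex of large norm will do, because its ratio is nonnegative. *)
have [gam0|gam0] := leP gam 0.
  have [|z z0 zdel] := @small_form (del / 9); first by rewrite divr_gt0.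
  have [|v [vV [v1 vN] _ D1 _]] := key z z0; first by exists 0.
  exists (int_vec R v); split=> //; apply: (@le_trans _ _ 0); first by lra.
  by rewrite divr_ge0 // ln_ge0 // ?ler1z // ltW.
have [C C0 CP] := form_norm_ge L_unit.
pose c := 3 / 2 * gam - eta.
pose d := ln `|\det L| - 3 * ln (54 : R).
(* [ln X > T1] forces some form at [z] below [del / 9]; [eta * T2] is the size of the error
   constants. *)
pose T1 := 1 - ln (del / 9) / gam.
pose T2 := (`|c * ln (9 * C)| + `|d|) / eta.
pose T := `|T1| + T2.
(* If all admissible points had norm at most [expR T], their integer preimages would lie in a ball
   and be finitely many. *)
have [z z0 [zT zP]] : exists2 z : 'cV[int]_3, z != 0 & expR T < `|L *m int_vec R z| /\
    Pi_mean (L *m int_vec R z) <= `|L *m int_vec R z| `^ (- gam).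
  apply: contrapT => nz; apply: inf.
  apply: (@sub_finite_set _ _ [set L *m int_vec R z | z in
      [set z | `|int_vec R z| <= C * expR T]]); last first.
    exact/finite_image/finite_int_ball.
  move=> _ [[z _ <-] zP] /=; exists z => //=; apply: (le_trans (CP z)).
  rewrite ler_wpM2l ?(ltW C0) // leNgt; apply/negP => h; apply: nz; exists z => //.
  apply: contraTneq h => ->.
  by rewrite int_vec0 mulmx0 normr0 -leNgt expR_ge0.
pose X := `|L *m int_vec R z|; pose P := \prod_i `|(L *m int_vec R z) i 0|.
have X0 : 0 < X by apply: lt_trans zT; exact: expR_gt0.
have P0 : 0 < P by apply: prodr_gt0 => i _; rewrite normr_gt0 L_irr.
have lnX : T < ln X by rewrite -[T]expRK ltr_ln ?posrE ?expR_gt0.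
have lnP : ln P <= - (3 * gam * ln X).
  move: zP; rewrite /Pi_mean normr_prod -/P -ler_ln ?posrE ?powR_gt0 // !ln_powR.
  by rewrite -/X; lra.
have T20 : 0 <= T2 by rewrite divr_ge0 ?addr_ge0 // ltW.
have TT1 : T1 <= T by have := ler_norm T1; rewrite /T; lra.
have TT2 : `|c * ln (9 * C)| + `|d| <= eta * T.
  by rewrite [eta * _]mulrC -ler_pdivrMr // -/T2 lerDr.
have [|v [vV [v1 vN] vz D1 Dz]] := key z z0.
  apply: contrapT => nsmall.
  have del9 : 0 < del / 9 by rewrite divr_gt0.
  have : (del / 9) ^+ 3 <= P.
    rewrite /P big_ord3 /= !exprS expr0 mulr1 mulrA.
    have h i : del / 9 <= `|(L *m int_vec R z) i 0|.
      by rewrite leNgt; apply/negP => hi; apply: nsmall; exists i.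
    by rewrite !ler_pM ?(ltW del9) // mulr_ge0 // ltW.
  rewrite -ler_ln ?posrE ?exprn_gt0 // lnXn // -[_ *+ 3]mulr_natl => h.
  have : - ln (del / 9) < gam * ln X.
    by rewrite [gam * _]mulrC -ltr_pdivrMr // mulNr; move: TT1; rewrite /T1; lra.
  by move: lnP h; lra.
exists (int_vec R v); split=> //.
have lnv0 : 0 < ln `|int_vec R v| by exact: ln_gt0.
have v0 : 0 < `|int_vec R v| by exact: lt_trans v1.
rewrite ler_pdivlMr // -/c.
have D0 : 0 < (det_star L (int_vec R v))%:~R :> R.
  by rewrite ltr0z; apply: lt_le_trans D1.
have lnD0 : 0 <= ln (det_star L (int_vec R v))%:~R :> R by rewrite ln_ge0 // ler1z.
have [c0|c0] := leP c 0.
  by apply: le_trans lnD0; rewrite mulr_le0_ge0 // ltW.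
have lnv : ln `|int_vec R v| <= ln (9 * C) + ln X.
  rewrite -lnM ?posrE ?mulr_gt0 // ler_ln ?posrE ?mulr_gt0 //.
  apply: (le_trans (CP v)); rewrite [9 * C]mulrC -mulrA.
  by rewrite ler_wpM2l // ltW.
have lnD : d <= 2 * ln (det_star L (int_vec R v))%:~R + ln P.
  have dL : 0 < `|\det L| by rewrite normr_gt0 -unitfE -unitmxE.
  move: Dz; rewrite -/P -ler_ln ?posrE ?mulr_gt0 ?exprn_gt0 //.
  by rewrite !lnM ?posrE ?mulr_gt0 ?exprn_gt0 // /d; lra.
have h1 := ler_norm (c * ln (9 * C)); have h2 := ler_norm (- d); rewrite normrN in h2.
have h3 : eta * T <= eta * ln X by rewrite ler_pM2l // ltW.
(* It remains to combine [2 ln D >= d + 3 gam ln X] with [eta ln X] exceeding all error terms. *)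
apply: (@le_trans _ _ (c * (ln (9 * C) + ln X))); first by rewrite ler_pM2l.
have cX : c * ln X = 3 / 2 * (gam * ln X) - eta * ln X by rewrite /c; ring.
have h4 : 0 <= `|d| by [].
by rewrite mulrDr cX; lra.
Qed.

End Final.

Theorem mainTheorem1 (R : realType) (L : 'M[R]_3)
    (L_indep : row_free L)
    (L_irr : forall (z : 'cV[int]_3) (i : 'I_3),
      z != 0 -> (L *m int_vec R z) i 0 != 0) :
  (diophantine_exponent (form_lattice L)
     <= (2 / 3)%:E * limsup_log_det_star L)%E.
Proof.
have L_unit : L \in unitmx by rewrite -row_free_unit.
apply: ge_ereal_sup => _ [gam inf <-].
have -> : gam = 2 / 3 * (3 / 2 * gam) by field.
rewrite EFinM; apply: lee_wpmul2l; first by rewrite lee_fin divr_ge0.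
(* The upper limit is an infimum, over sets [V] containing all vertices of norm above some [N], of
   suprema; each supremum is bounded below up to every [eta > 0]. *)
rewrite /limsup_log_det_star limf_esupE.
apply: le_ereal_inf_tmp => _ [V [N _ NV] <-].
apply/lee_subgt0Pr => eta eta0.
have [v [vV v1 vN rv]] := vertex_ratio L_unit L_irr N eta0 inf.
apply: (le_trans _ (ereal_sup_ubound _)); last by exists v; [apply: NV|].
by rewrite lee_fin.
Qed.
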